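(* Let $n\in\mathbb{N}$, $n\geq 3$. There exist polynomial functions $f_j,g_j:\mathbb{R}^2\to\mathbb{R}$, $j=1,\ldots,5$, such that for all sufficiently small $\varepsilon>0$ the system $$\dot x=-\varepsilon\prod_{k=1}^{2n-1}(x-k)+\sum_{j=1}^5 y_j f_j(x,y_j),\qquad \dot y_j=y_j\,g_j(x,y_j)\quad (j=1,\ldots,5)$$ on $\mathbb{R}^6_{y\geq 0}$ realises the DNN graph with $n$ vertices as a heteroclinic network between the nodes $\xi_k:=(2k-1,0,0,0,0,0)$, $k=1,\ldots,n$ (with node $\xi_k$ corresponding to vertex $v_k$).
   Context: Coordinates in $\mathbb{R}^N$ are $(x,y_1,\ldots,y_{N-1})$, and $\mathbb{R}^N_{y\geq 0}$ denotes the set of points with $y_j\geq 0$ for all $j$. DNN graph (double-next-neighbour graph): the directed graph with vertices $v_1,\ldots,v_n$ and edges exactly $[v_k\to v_{k+1}]$ and $[v_k\to v_{k+2}]$ for all $k$, indices modulo $n$. Heteroclinic cycle: finitely many equilibria $\xi_1,\ldots,\xi_m$ together with trajectories connecting them cyclically, $W^u(\xi_k)\cap W^s(\xi_{k+1})\neq\emptyset$ for all $k$ modulo $m$. Heteroclinic network: a connected union of more than one, and finitely many, heteroclinic cycles. Realisation: a system with designated equilibria $\xi_1,\ldots,\xi_n$, called nodes, realises a digraph on $v_1,\ldots,v_n$ if vertices correspond one-to-one to nodes and edges correspond to heteroclinic connections between nodes: for all $i,j$, a nonconstant trajectory in the phase space $\mathbb{R}^N_{y\geq0}$ with $\alpha$-limit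 $\xi_i$ and $\omega$-limit $\xi_j$ exists if and only if $[v_i\to v_j]$ is an edge. The system may have further equilibria that are not nodes; these are not part of the correspondence. *)

(* Defs.v *)
From mathcomp Require Import all_boot all_order all_algebra polyXY.
From mathcomp Require Import all_classical all_reals all_analysis.

Set Implicit Arguments.
Unset Strict Implicit.
Unset Printing Implicit Defensive.

Import Order.TTheory GRing.Theory Num.Theory.
Import numFieldNormedType.Exports.

Local Open Scope classical_set_scope.
Local Open Scope ring_scope.

(* The dynamics of z' = F z is considered on a phase space D. *)

Definition trajectory (R : realType) (V : normedModType R)
    (D : set V) (F : V -> V) (phi : R -> V) : Prop :=
  forall t : R, D (phi t) /\ is_derive t 1 phi (F (phi t)).

Definition equilibrium (R : realType) (V : normedModType R)
    (D : set V) (F : V -> V) (z : V) : Prop :=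
  D z /\ F z = 0.

(* An alpha- (omega-) limit equal to a single point z is convergence to z in
   backward (forward) time; such a solution exists for all times. *)
Definition connection (R : realType) (V : normedModType R)
    (D : set V) (F : V -> V) (a b : V) (phi : R -> V) : Prop :=
  [/\ trajectory D F phi,
      exists s t : R, phi s <> phi t,
      phi t @[t --> -oo] --> a
    & phi t @[t --> +oo] --> b].

(* Gamma k is the set of those trajectories from z k to z (k + 1), indices
   modulo m, that belong to the cycle; it may be all of them, because the
   intersection of W^u(z k) and W^s(z (k + 1)) can contain many orbits. *)
Definition heteroclinic_cycle (R : realType) (V : normedModType R)
    (D : set V) (F : V -> V) (X : set V) : Prop :=
  exists (m : nat) (z : 'I_m -> V) (Gamma : 'I_m -> set (R -> V)),
    [/\ (0 < m)%N,
        injective z,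
        forall k, equilibrium D F (z k),
        forall k, Gamma k !=set0 /\
          Gamma k `<=` connection D F (z k) (z (ordS k))
      & X = range z `|`
            \bigcup_(k in [set: 'I_m]) \bigcup_(phi in Gamma k) range phi].

Definition heteroclinic_network (R : realType) (V : normedModType R)
    (D : set V) (F : V -> V) (X : set V) : Prop :=
  connected X /\
  exists (r : nat) (C : 'I_r -> set V),
    [/\ (1 < r)%N,
        injective C,
        forall i, heteroclinic_cycle D F (C i)
      & X = \bigcup_(i in [set: 'I_r]) C i].

(* A digraph on the vertices 'I_n is given by its edge relation e. *)
Definition realises (R : realType) (V : normedModType R)
    (D : set V) (F : V -> V) (n : nat) (xi : 'I_n -> V) (e : rel 'I_n) : Prop :=
  [/\ injective xi,
      forall i, equilibrium D F (xi i)
    & forall i j, (exists phi, connection D F (xi i) (xi j) phi) <-> e i j].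

Definition nodes_and_connections (R : realType) (V : normedModType R)
    (D : set V) (F : V -> V) (n : nat) (xi : 'I_n -> V) : set V :=
  range xi `|`
  [set p | exists i j phi, connection D F (xi i) (xi j) phi /\ range phi p].

Definition realises_as_network (R : realType) (V : normedModType R)
    (D : set V) (F : V -> V) (n : nat) (xi : 'I_n -> V) (e : rel 'I_n) : Prop :=
  realises D F xi e /\
  heteroclinic_network D F (nodes_and_connections D F xi).

(* The vertex v_(i+1) is i : 'I_n, and ordS is the successor modulo n. *)
Definition dnn (n : nat) : rel 'I_n :=
  fun i j => (j == ordS i) || (j == ordS (ordS i)).

(* R^(m+1) is 'rV[R]_m.+1: coordinate ord0 is x and coordinate lift ord0 j is
   the one of the y's with (zero-based) index j : 'I_m. *)
Definition xcoord (R : realType) (m : nat) (z : 'rV[R]_m.+1) : R := z ord0 ord0.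

Definition ycoord (R : realType) (m : nat) (z : 'rV[R]_m.+1) (j : 'I_m) : R :=
  z ord0 (lift ord0 j).

Definition phase_space (R : realType) (m : nat) : set 'rV[R]_m.+1 :=
  [set z | forall j, 0 <= ycoord z j].

Definition vector_field (R : realType) (m n : nat)
    (f g : 'I_m -> {poly {poly R}}) (eps : R) (z : 'rV[R]_m.+1) : 'rV[R]_m.+1 :=
  let x := xcoord z in
  let y := ycoord z in
  \row_i
    if unlift ord0 i is Some j then y j * (g j).[x, y j]
    else - eps * \prod_(1 <= k < 2 * n) (x - k%:R)
         + \sum_j y j * (f j).[x, y j].

(* i : 'I_n stands for the index k = i + 1, so that 2k - 1 = 2i + 1. *)
Definition node (R : realType) (m n : nat) (i : 'I_n) : 'rV[R]_m.+1 :=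
  \row_l if l == ord0 then (2 * i + 1)%:R else 0.

(* Main.v *)
(* The vector field is chosen so that at every node exactly one of the five
   transverse directions y_l is attracting, the label of the node.  On a
   connection to a node only the y with the label of that node can be positive,
   so that every connection lies in a plane (x, y_l), and it remains to study
   five planar systems.

   Labels 0, 1, 2: the third and later nodes carry their index modulo 3.  Here
   f >= 0 pushes x to the right, and f vanishes at the nodes of the label and at
   one even integer, all of them roots of the drift.  These zeros are walls, and
   exactly the two nodes before a target lie between it and the preceding wall.
   Labels 3, 4: the first two nodes, at x = tau.  In terms of u = x - tau the
   function f is a cubic that lets the orbits of the last nodes travel back to
   tau above the middle nodes, whereas an orbit that leaves a middle node stays
   in the box 3/2 < u < 2n - 5, y < 2.

   In a plane, orbits that start on y > 0 at the line x = s of the source remain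
   in a cone y >= kappa (x - s) until x = m, their x increases, and y is bounded
   because (1 + y) exp (- 2 C x) decreases where y >= 1; hence they converge to
   the target.  Letting the initial y tend to 0, a limit of the orbits, shifted
   in time to y = delta, is the connection.  The parameter eps has to be small
   only here, where the drift must not push the orbits out of the cone. *)

Require Import Defs.
From mathcomp Require Import all_boot all_order all_algebra.
From mathcomp Require Import polyXY.
From mathcomp Require Import all_classical all_reals all_analysis.
From mathcomp Require Import ring lra.
From mathcomp Require Import zify.
Import numFieldNormedType.Exports.
Import Order.TTheory GRing.Theory Num.Theory.
Local Open Scope classical_set_scope.
Local Open Scope ring_scope.
Set Implicit Arguments.
Unset Strict Implicit.
Unset Printing Implicit Defensive.

(** * Primitives and comparison arguments on the line *)

Section RealCalculus.
Context {R : realType}.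
Implicit Types (h : R -> R) (a b t : R).

(** At each node four of the five transverse directions repel, so a [y_l] that is positive on a
    connection can tend to 0 in forward time only if [l] is the label of the target, and in backward
    time only if [l] is not the label of the source. Inside the remaining plane, unwanted
    connections are excluded for every [eps > 0] by invariance: a common root of the drift and of
    [f] makes a vertical line invariant, which is why walls are placed at roots of the drift. Walls
    do not help for the first two nodes. Orbits of the last nodes must come back across the middle
    ones, and an [f] of [x] alone that pushes them left would push the orbits of the middle nodes in
    the same way. Hence this [f] depends on the height [y]. The price is that [y] must climb steeply
    before [x] reaches the middle, which accounts for the large factor in [g]. Existence needs no
    linearisation at the source: the cone takes over the role of an unstable manifold, and the
    alpha-limit follows from a squeeze between the cone and an exponential bound on [y]. *)

Lemma is_derive_continuous (u : R -> R) (u' t : R) : is_derive t 1 u u' -> {for t, continuous u}.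
Proof. by move=> [du _]; exact/differentiable_continuous/derivable1_diffP. Qed.

Lemma is_derive_within (u u' : R -> R) (A : set R) :
  (forall t, is_derive t 1 u (u' t)) -> {within A, continuous u}.
Proof.
by move=> du; apply: continuous_subspaceT => t; exact: is_derive_continuous (du t).
Qed.

Lemma mean_value (u u' : R -> R) a b : (forall t, is_derive t 1 u (u' t)) ->
  a < b -> exists2 c, a < c < b & u b - u a = u' c * (b - a).
Proof.
move=> du ab; have [|c cab ->] := @MVT R u u' a b ab (fun x _ => du x).
  exact: is_derive_within du.
by exists c => //; move: cab; rewrite in_itv.
Qed.

Lemma derive_ge0_le (u u' : R -> R) a b : (forall t, is_derive t 1 u (u' t)) ->
  a <= b -> (forall t, a < t < b -> 0 <= u' t) -> u a <= u b.
Proof.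
move=> du; rewrite le_eqVlt => /predU1P[-> //|ab] u'0.
have [c cab uE] := mean_value du ab.
by rewrite -subr_ge0 uE mulr_ge0 ?subr_ge0 ?(ltW ab) // u'0.
Qed.

Lemma ivt (u u' : R -> R) a b v : (forall t, is_derive t 1 u (u' t)) ->
  a <= b -> Num.min (u a) (u b) <= v <= Num.max (u a) (u b) ->
  exists2 c, a <= c <= b & u c = v.
Proof.
move=> du ab uv; have [|c cab <-] := @IVT R u a b v ab _ uv.
  exact: is_derive_within du.
by exists c => //; move: cab; rewrite in_itv.
Qed.

(** Integrals from [- N] give primitives to the right of [- N]; normalised at 0 they agree for
    different [N] and glue to one on the whole line. *)
Lemma continuous_primitive h : continuous h ->
  exists2 H, H 0 = 0 & forall t, is_derive t 1 H (h t).
Proof.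
move=> ch.
pose G N t := (\int[lebesgue_measure]_(x in [set` `[- N, t]]) h x)%R : R.
have dG (N t : R) : - N < t -> is_derive t 1 (G N) (h t).
  move=> Nt.
  have ih : lebesgue_measure.-integrable `[- N, t + 1] (EFin \o h).
    apply: continuous_compact_integrable; first exact: segment_compact.
    exact: continuous_subspaceT.
  have tt : t < t + 1 by rewrite ltrDl.
  have [d1 d2] := continuous_FTC1_closed tt ih Nt (ch t).
  by apply: DeriveDef; [exact: d1 | rewrite -derive1E; exact: d2].
pose F N t := G N t - G N 0.
have dF (N t : R) : - N < t -> is_derive t 1 (F N) (h t).
  move=> Nt; have := dG _ _ Nt => dGt.
  by apply: is_derive_eq; rewrite subr0.
have FF (N M t : R) : 0 < N -> N <= M -> - N < t -> F N t = F M t.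
  move=> N0 NM Nt.
  have M0 : 0 < M by lra.
  pose D s := F N s - F M s.
  have dD s : - N < s -> is_derive s 1 D 0.
    move=> Ns; have Ms : - M < s by lra.
    have := dF _ _ Ns; have := dF _ _ Ms => ? ?.
    by apply: is_derive_eq; rewrite subrr.
  have D0 : D 0 = 0 by rewrite /D /F !subrr.
  have cD a b : - N < a -> {within `[a, b], continuous D}.
    move=> Na; apply: continuous_in_subspaceT => s; rewrite inE/= in_itv/= => /andP[? _].
    by apply: (is_derive_continuous (dD s _)); lra.
  suff : D t = 0 by move/eqP; rewrite subr_eq0 => /eqP.
  case: (leP 0 t) => t0.
    have [||c _] := @MVT_segment R D (fun=> 0) 0 t t0.
    - by move=> s; rewrite in_itv/= => /andP[? _]; apply: dD; lra.
    - by apply: cD; lra.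
    by rewrite mul0r D0 subr0.
  have [||c _] := @MVT_segment R D (fun=> 0) t 0 (ltW t0).
  - by move=> s; rewrite in_itv/= => /andP[? _]; apply: dD; lra.
  - exact: cD.
  by rewrite mul0r D0 sub0r => /eqP; rewrite oppr_eq0 => /eqP.
(* The lower end moves with [t]; near a given point one fixed, lower end gives the same function. *)
exists (fun t => F (`|t| + 1) t); first by rewrite /F subrr.
move=> t; have Nt : - (`|t| + 2) < t.
  by have := ler_norm (- t); rewrite normrN; lra.
apply: near_eq_is_derive (dF _ _ Nt).
near=> s.
have st : `|s - t| < 1 by rewrite distrC; near: s; exact: cvgr_dist_lt.
have ns : `|s| <= `|s - t| + `|t|.
  by have := ler_normD (s - t) t; rewrite subrK.
apply/esym/FF.
- by have := normr_ge0 s; lra.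
- by lra.
- by have := ler_norm (- s); rewrite normrN; lra.
Unshelve. all: by end_near. Qed.

End RealCalculus.

(** * Gronwall estimates and barriers for scalar functions *)

Section Comparison.
Context {R : realType}.
Implicit Types (a b c t l : R).

Lemma gronwall (u u' : R -> R) (K : R) : (forall t, is_derive t 1 u (u' t)) ->
  (forall t, `|u' t| <= K * u t) ->
  forall s t, u t <= u s * expR (K * `|t - s|).
Proof.
move=> du u'K s t.
have dE (k x : R) : is_derive x 1 (fun x => u x * expR (k * (x - s)))
    (expR (k * (x - s)) * (u' x + k * u x)).
  have := du x => ?.
  by apply: is_derive_eq; rewrite /GRing.scale/=; ring.
have bnd x : - (K * u x) <= u' x <= K * u x by rewrite -ler_norml.
have E0 (x : R) : expR (x * (s - s)) = 1 :> R by rewrite subrr mulr0 expR0.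
have [st|ts] := leP s t.
  rewrite ger0_norm ?subr_ge0 // -ler_pdivrMr ?expR_gt0 // -expRN.
  have /= := @derive_ge0_le R (fun x => - (u x * expR (- K * (x - s)))) _ s t
    (fun x => is_deriveN (dE _ x)) st.
  rewrite E0 mulr1 lerN2 mulNr; apply => x _.
  rewrite oppr_ge0 mulr_ge0_le0 ?expR_ge0 //.
  by have /andP[] := bnd x; lra.
rewrite ltr0_norm ?subr_lt0 // -ler_pdivrMr ?expR_gt0 // -expRN.
have /= := @derive_ge0_le R (fun x => u x * expR (K * (x - s))) _ t s (dE K) (ltW ts).
rewrite E0 mulr1 mulrN opprK; apply=> x _.
rewrite mulr_ge0 ?expR_ge0 //.
by have /andP[] := bnd x; lra.
Qed.

(** Gronwall's estimate for [u * u], run from a zero back to [s], rules out a zero; the intermediate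
    value theorem does the rest. *)
Lemma stays_pos (u u' : R -> R) (K : R) : (forall t, is_derive t 1 u (u' t)) ->
  (forall t, `|u' t| <= K * `|u t|) ->
  forall s, 0 < u s -> forall t, 0 < u t.
Proof.
move=> du u'K s us t.
have dW (x : R) : is_derive x 1 (fun x => u x * u x) (2 * u x * u' x).
  have := du x => ?.
  by apply: is_derive_eq; rewrite /GRing.scale/=; ring.
have nz x : u x != 0.
  apply: contraTneq us => ux0.
  have := @gronwall _ _ (2 * K) dW _ x s.
  rewrite ux0 mulr0 mul0r => H; rewrite -leNgt leNgt; apply/negP => us.
  have : 0 < u s * u s by rewrite mulr_gt0.
  rewrite ltNge H // => y.
  have -> : u y * u y = `|u y| * `|u y| by rewrite -normrM ger0_norm // -expr2 sqr_ge0.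
  rewrite !normrM ger0_norm //.
  by have := u'K y; have := normr_ge0 (u y); nra.
rewrite lt_neqAle eq_sym nz /= leNgt; apply/negP => ut.
have [st|/ltW ts] := leP s t.
  have [|c _ /eqP] := @ivt R u u' s t 0 du st; last exact/negP.
  by rewrite ge_min le_max (ltW ut) (ltW us) ?orbT.
have [|c _ /eqP] := @ivt R u u' t s 0 du ts; last exact/negP.
by rewrite ge_min le_max (ltW ut) (ltW us) ?orbT.
Qed.

Lemma last_crossing (u : R -> R) a b l : continuous u -> a <= b -> l <= u a -> u b < l ->
  exists c, [/\ a <= c < b, u c = l & forall t, c < t <= b -> u t < l].
Proof.
move=> cu ab la lb.
pose S := [set t | a <= t <= b /\ l <= u t].
have Sa : S a by split=> //; rewrite lexx.
have supS : has_sup S by split; [exists a | exists b => t [/andP[]]].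
pose c := sup S.
have cb : c <= b by apply: ge_sup; [exists a | move=> t [/andP[]]].
have ac : a <= c by exact: sup_upper_bound.
have after t : c < t <= b -> u t < l.
  move=> /andP[ct tb]; rewrite ltNge; apply/negP => lt.
  suff : t <= c by rewrite leNgt ct.
  by apply: sup_upper_bound => //; split=> //; rewrite tb andbT (le_trans ac) // ltW.
have uc1 : l <= u c.
  rewrite leNgt; apply/negP => ucl.
  have [/= e e0 He] : \forall t \near c, u t < l by exact: cvgr_lt (cu c) _ ucl.
  have [x Sx] := sup_adherent e0 supS.
  rewrite -/c => cx; have xc : x <= c by exact: sup_upper_bound.
  have xl : l <= u x by case: Sx.
  suff : u x < l by rewrite ltNge xl.
  by apply: He; rewrite /ball_/= ger0_norm ?subr_ge0 //; lra.
have cltb : c < b by rewrite lt_neqAle cb andbT; apply: contraTneq uc1 => ->; rewrite -ltNge.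
exists c; split; [by rewrite ac | | exact: after].
apply/eqP; rewrite eq_le uc1 andbT leNgt; apply/negP => ucl.
have [/= e e0 He] : \forall t \near c, l < u t by exact: cvgr_gt (cu c) _ ucl.
pose d := Num.min (e / 2) (b - c).
have d0 : 0 < d by rewrite lt_min subr_gt0 cltb divr_gt0.
have /He : `|c - (c + d)| < e.
  rewrite opprD addrA subrr sub0r normrN gtr0_norm //.
  by rewrite gt_min; apply/orP; left; lra.
have : c + d <= b by rewrite -lerBrDl ge_min lexx orbT.
move=> cdb; have /after : c < c + d <= b by rewrite cdb ltrDl d0.
by move=> /ltW; rewrite leNgt => /negP.
Qed.

Lemma derive_pos_increases (u : R -> R) (d c b : R) : is_derive c 1 u d -> 0 < d -> c < b ->
  exists2 t, c < t <= b & u c < u t.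
Proof.
move=> [dc dE] d0 cb.
have : (fun h : R => h^-1 *: (u (h *: 1 + c) - u c)) @ 0^' --> d.
  by rewrite -dE; exact: dc.
move=> /cvgr_gt /(_ 0 d0) [/= e e0 He].
pose h := Num.min (e / 2) (b - c).
have h0 : 0 < h by rewrite lt_min subr_gt0 cb divr_gt0.
exists (c + h); first by rewrite ltrDl h0 -lerBrDl ge_min lexx orbT.
have := He h; rewrite /ball_/= sub0r normrN gtr0_norm // gt_eqF //.
have he : h < e by rewrite gt_min; apply/orP; left; lra.
move=> /(_ he isT).
by rewrite /GRing.scale /= mulr1 pmulr_rgt0 ?invr_gt0 // subr_gt0 addrC.
Qed.

(** At the last time on the level before a stay below it the derivative would be positive, so that
    [u] would exceed the level just afterwards. *)
Lemma upcrossing (u u' : R -> R) (l a b : R) : (forall t, is_derive t 1 u (u' t)) ->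
  a <= b -> (forall t, a <= t <= b -> u t = l -> 0 < u' t) ->
  l <= u a -> l <= u b.
Proof.
move=> du ab up la; rewrite leNgt; apply/negP => lb.
have [|c [/andP[ac cb] cl after]] := last_crossing _ ab la lb.
  by move=> t; exact: is_derive_continuous (du t).
have [|t tb ut] := derive_pos_increases (du c) _ cb.
  by apply: up => //; rewrite ac ltW.
by move: (after t tb); rewrite -cl => /ltW; rewrite leNgt ut.
Qed.

Lemma stays_ge (u u' : R -> R) (l a b : R) : (forall t, is_derive t 1 u (u' t)) ->
  a <= b -> (forall t, a <= t <= b -> u t < l -> 0 <= u' t) ->
  l <= u a -> l <= u b.
Proof.
move=> du ab up la; rewrite leNgt; apply/negP => lb.
have [|c [/andP[ac cb] cl after]] := last_crossing _ ab la lb.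
  by move=> t; exact: is_derive_continuous (du t).
suff : u c <= u b by rewrite cl leNgt lb.
apply: (derive_ge0_le du (ltW cb)) => t /andP[ct tb].
by apply: up; [rewrite (le_trans ac) ltW | apply: after; rewrite ct ltW].
Qed.

End Comparison.

(** * Global existence for Lipschitz planar systems *)

Section Picard.
Context {R : realType}.

(* Lipschitz in the sense of the 1-norm of R^2, on the set [D]. *)
Definition lipschitz2 (D : R -> R -> Prop) (L : R) (F : R -> R -> R) :=
  forall x y x' y', D x y -> D x' y' ->
    `|F x y - F x' y'| <= L * (`|x - x'| + `|y - y'|).

(** Integration gains a factor [1 / a] against the weight [expR (a * |t|)]. This is what makes the
    Picard iteration converge on the whole line at once. *)
Lemma exp_comparison (u u' : R -> R) (a K : R) : 0 < a -> 0 <= K -> u 0 = 0 ->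
  (forall t : R, is_derive t 1 u (u' t)) ->
  (forall t, `|u' t| <= K * a * expR (a * `|t|)) ->
  forall t, `|u t| <= K * expR (a * `|t|).
Proof.
move=> a0 K0.
have half (v v' : R -> R) t : v 0 = 0 -> (forall t : R, is_derive t 1 v (v' t)) ->
    (forall t, `|v' t| <= K * a * expR (a * `|t|)) -> 0 <= t ->
    v t <= K * expR (a * t).
  move=> v0 dv v'K t0.
  have dphi (s : R) : is_derive s 1 (fun s => K * expR (a * s) - v s)
      (K * a * expR (a * s) - v' s).
    have := dv s => ?.
    by apply: is_derive_eq; rewrite /GRing.scale/=; ring.
  suff : K * expR (a * 0) - v 0 <= K * expR (a * t) - v t.
    by rewrite v0 mulr0 expR0; lra.
  apply: (derive_ge0_le dphi t0) => s /andP[s0 _].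
  have := v'K s; rewrite (gtr0_norm s0); have := ler_norm (v' s); lra.
have full (v v' : R -> R) t : v 0 = 0 -> (forall t : R, is_derive t 1 v (v' t)) ->
    (forall t, `|v' t| <= K * a * expR (a * `|t|)) ->
    v t <= K * expR (a * `|t|).
  move=> v0 dv v'K; case: (leP 0 t) => t0.
    by rewrite (ger0_norm t0); exact: half v'K t0.
  have vN0 : (fun s => v (- s)) 0 = 0 by rewrite oppr0.
  have dvN (s : R) : is_derive s 1 (fun s => v (- s)) (- v' (- s)).
    have := dv (- s) => ?; have := is_derive1_comp (f := v) (g := -%R) (x := s).
    by move=> /(_ _ _ _ (is_deriveNid s 1)) H; apply: is_derive_eq; rewrite mulrN1.
  have bN s : `|- v' (- s)| <= K * a * expR (a * `|s|).
    by rewrite normrN (le_trans (v'K _)) // normrN.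
  by have := half (fun s => v (- s)) _ (- t) vN0 dvN bN; rewrite opprK ltr0_norm //; apply; lra.
move=> u0 du u'K t; rewrite ler_norml (full _ _ _ u0 du) // andbT lerNl.
apply: (full (fun s => - u s) (fun s => - u' s)) => [|s]; first by rewrite u0 oppr0.
by rewrite normrN.
Qed.

(** The intervals of radius [c k] about [x k] are nested; [l] is the supremum of their left ends. *)
Lemma geometric_cauchy (x : nat -> R) (C : R) :
  (forall k, `|x k.+1 - x k| <= C / 2 ^+ k) ->
  exists l, forall k, `|l - x k| <= 2 * C / 2 ^+ k.
Proof.
move=> xC; pose c k := 2 * C / 2 ^+ k.
have cE k : c k.+1 = C / 2 ^+ k by rewrite /c exprS; field; rewrite expf_neq0.
have {xC} xc k : `|x k.+1 - x k| <= c k.+1 by rewrite cE.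
have half k : c k.+1 = c k / 2 by rewrite cE /c; field; rewrite expf_neq0.
have c0 k : 0 <= c k by have := xc k; rewrite half; have := normr_ge0 (x k.+1 - x k); lra.
have lo k m : x k - c k <= x (k + m)%N - c (k + m)%N.
  elim: m => [|m IH]; first by rewrite addn0.
  apply: (le_trans IH); rewrite addnS; have := xc (k + m)%N.
  by rewrite ler_norml half => /andP[]; lra.
have hi k m : x (k + m)%N + c (k + m)%N <= x k + c k.
  elim: m => [|m IH]; first by rewrite addn0.
  apply: le_trans IH; rewrite addnS; have := xc (k + m)%N.
  by rewrite ler_norml half => /andP[_]; lra.
pose S := range (fun k => x k - c k).
have ubS k : ubound S (x k + c k).
  move=> _ [m _ <-]; apply: (le_trans (lo m k)).
  rewrite addnC; apply: le_trans (hi k m).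
  by have := c0 (k + m)%N; lra.
have S0 : S !=set0 by exists (x 0%N - c 0%N); exists 0%N.
exists (sup S) => k; rewrite -/(c k) ler_norml; apply/andP; split.
  have : x k - c k <= sup S.
    apply: sup_upper_bound; last by exists k.
    by split=> //; exists (x 0%N + c 0%N).
  by lra.
by have := ge_sup S0 (@ubS k); lra.
Qed.

Lemma continuous_lipschitz2 (F : R -> R -> R) (L : R) (X Y : R -> R) : 0 <= L ->
  lipschitz2 (fun _ _ => True) L F -> continuous X -> continuous Y ->
  continuous (fun t => F (X t) (Y t)).
Proof.
move=> L0 LF cX cY t; apply/cvgrPdist_le => /= e e0.
have e1 : 0 < e / (L + 1) / 2 by rewrite !divr_gt0 // ltr_wpDl.
near=> s.
have hX : `|X t - X s| <= e / (L + 1) / 2 by near: s; exact: cvgr_dist_le (cX t) _ e1.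
have hY : `|Y t - Y s| <= e / (L + 1) / 2 by near: s; exact: cvgr_dist_le (cY t) _ e1.
apply: (le_trans (LF _ _ _ _ I I)).
have : L * (e / (L + 1)) <= e by rewrite mulrA ler_pdivrMr ?ltr_wpDl //; nra.
by apply: le_trans; rewrite ler_wpM2l //; lra.
Unshelve. all: by end_near. Qed.

(** * Picard iteration in a weighted norm *)

Section Iteration.
Variables (F1 F2 : R -> R -> R) (L x0 y0 : R).
Hypotheses (L0 : 0 < L) (LF1 : lipschitz2 (fun _ _ => True) L F1)
  (LF2 : lipschitz2 (fun _ _ => True) L F2).

(** Total in [h], with default [cst 0], so that the iteration can be defined before its iterates are
    known to be continuous. *)
Let primitive (h : R -> R) : R -> R :=
  if pselect (continuous h) is left ch then sval (cid2 (continuous_primitive ch))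
  else cst 0.

Let primitiveP h : continuous h ->
  primitive h 0 = 0 /\ forall t : R, is_derive t 1 (primitive h) (h t).
Proof. by move=> ch; rewrite /primitive; case: pselect => // ch'; case: cid2. Qed.

Let picard_step (S : (R -> R) * (R -> R)) : (R -> R) * (R -> R) :=
  (fun t => x0 + primitive (fun t => F1 (S.1 t) (S.2 t)) t,
   fun t => y0 + primitive (fun t => F2 (S.1 t) (S.2 t)) t).

Let iterate k := iter k picard_step ((fun=> x0), (fun=> y0)).

Let continuous_along (F : R -> R -> R) (X Y : R -> R) :
  lipschitz2 (fun _ _ => True) L F -> continuous X -> continuous Y ->
  continuous (fun t => F (X t) (Y t)).
Proof. exact: continuous_lipschitz2 (ltW L0). Qed.

Let step_derive S : continuous S.1 -> continuous S.2 ->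
  (forall t : R, is_derive t 1 (picard_step S).1 (F1 (S.1 t) (S.2 t))) /\
  (forall t : R, is_derive t 1 (picard_step S).2 (F2 (S.1 t) (S.2 t))).
Proof.
move=> c1 c2; split=> t.
  have [_ /(_ t) H] := primitiveP (continuous_along LF1 c1 c2).
  exact: is_derive_eq (is_deriveD (is_derive_cst x0 t 1) H) (add0r _).
have [_ /(_ t) H] := primitiveP (continuous_along LF2 c1 c2).
exact: is_derive_eq (is_deriveD (is_derive_cst y0 t 1) H) (add0r _).
Qed.

Let iterate_continuous k : continuous (iterate k).1 /\ continuous (iterate k).2.
Proof.
elim: k => [|k [c1 c2]]; first by split=> t; exact: cvg_cst.
by have [d1 d2] := step_derive c1 c2; split=> t; exact: is_derive_continuous.
Qed.

Let iterate_derive k :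
  (forall t : R, is_derive t 1 (iterate k.+1).1 (F1 ((iterate k).1 t) ((iterate k).2 t))) /\
  (forall t : R, is_derive t 1 (iterate k.+1).2 (F2 ((iterate k).1 t) ((iterate k).2 t))).
Proof. by have [c1 c2] := iterate_continuous k; exact: step_derive. Qed.

Let iterate0 k : (iterate k).1 0 = x0 /\ (iterate k).2 0 = y0.
Proof.
case: k => [//|k]; have [c1 c2] := iterate_continuous k => /=.
have [-> _] := primitiveP (continuous_along LF1 c1 c2).
by have [-> _] := primitiveP (continuous_along LF2 c1 c2); rewrite !addr0.
Qed.

(** [M] bounds the first step of the iteration in the norm weighted by [E]. In the rate [4 * L], one
    factor 2 comes from the two coordinates in the 1-norm and the other one is the contraction. *)
Let M := (`|F1 x0 y0| + `|F2 x0 y0|) / L.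
Let E (t : R) := expR (4 * L * `|t|).

Let M0 : 0 <= M.
Proof. by rewrite divr_ge0 ?addr_ge0 // ltW. Qed.

(* The weight [E] turns the Picard operator into a contraction of ratio 1/2. *)
Let step_contracts (F : R -> R -> R) (X Y X' Y' u v : R -> R) (C : R) :
  lipschitz2 (fun _ _ => True) L F -> 0 <= C -> u 0 = v 0 ->
  (forall t : R, is_derive t 1 u (F (X t) (Y t))) ->
  (forall t : R, is_derive t 1 v (F (X' t) (Y' t))) ->
  (forall t, `|X t - X' t| <= C * E t) -> (forall t, `|Y t - Y' t| <= C * E t) ->
  forall t, `|u t - v t| <= C / 2 * E t.
Proof.
move=> LF C0 uv0 du dv dX dY.
apply: (@exp_comparison (fun t => u t - v t) (fun t => F (X t) (Y t) - F (X' t) (Y' t))).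
- by rewrite mulr_gt0.
- by rewrite divr_ge0.
- by rewrite uv0 subrr.
move=> t; apply: (le_trans (LF _ _ _ _ I I)).
have -> : C / 2 * (4 * L) * expR (4 * L * `|t|) = L * (C * E t + C * E t).
  by rewrite /E; field.
by rewrite ler_wpM2l ?(ltW L0) // lerD.
Qed.

Let iterate_dist k t : `|(iterate k.+1).1 t - (iterate k).1 t| <= M / 2 ^+ k * E t /\
  `|(iterate k.+1).2 t - (iterate k).2 t| <= M / 2 ^+ k * E t.
Proof.
elim: k t => [|k IH] t.
  have [d1 d2] := iterate_derive 0.
  have a0 : 0 < 4 * L by rewrite mulr_gt0.
  rewrite !expr0 !divr1.
  have bnd (F : R -> R -> R) s : `|F x0 y0| <= `|F1 x0 y0| + `|F2 x0 y0| ->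
      `|F x0 y0| <= M * (4 * L) * expR (4 * L * `|s|).
    move=> /le_trans; apply.
    have -> : M * (4 * L) = (`|F1 x0 y0| + `|F2 x0 y0|) * 4.
      by rewrite /M; field; rewrite gt_eqF.
    have : 1 <= expR (4 * L * `|s|) by apply: le_trans (expR_ge1Dx _); rewrite lerDl mulr_ge0 // ltW.
    by have := normr_ge0 (F1 x0 y0); have := normr_ge0 (F2 x0 y0); nra.
  split.
    apply: (@exp_comparison (fun t => (iterate 1).1 t - x0) (fun=> F1 x0 y0)) => //.
    - by have [-> _] := iterate0 1; rewrite subrr.
    - by move=> s; have := d1 s => ?; apply: is_derive_eq; rewrite subr0.
    - by move=> s; apply: bnd; rewrite lerDl.
  apply: (@exp_comparison (fun t => (iterate 1).2 t - y0) (fun=> F2 x0 y0)) => //.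
  - by have [_ ->] := iterate0 1; rewrite subrr.
  - by move=> s; have := d2 s => ?; apply: is_derive_eq; rewrite subr0.
  - by move=> s; apply: bnd; rewrite lerDr.
have [d1 d2] := iterate_derive k; have [d1' d2'] := iterate_derive k.+1.
have C0 : 0 <= M / 2 ^+ k by rewrite divr_ge0 // exprn_ge0.
have -> : M / 2 ^+ k.+1 = M / 2 ^+ k / 2 by rewrite exprS; field; rewrite expf_neq0.
have [i1 i2] := iterate0 k.+1; have [i1' i2'] := iterate0 k.+2.
have IH1 s := (IH s).1; have IH2 s := (IH s).2.
have e1 : (iterate k.+2).1 0 = (iterate k.+1).1 0 by rewrite i1 i1'.
have e2 : (iterate k.+2).2 0 = (iterate k.+1).2 0 by rewrite i2 i2'.
split; first exact: (step_contracts LF1 C0 e1 d1' d1).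
exact: (step_contracts LF2 C0 e2 d2' d2).
Qed.

Let limit_exists : exists S : (R -> R) * (R -> R), forall k t,
  `|S.1 t - (iterate k).1 t| <= 2 * M / 2 ^+ k * E t /\
  `|S.2 t - (iterate k).2 t| <= 2 * M / 2 ^+ k * E t.
Proof.
have H (f : nat -> R -> R) : (forall k t, `|f k.+1 t - f k t| <= M / 2 ^+ k * E t) ->
    exists g, forall k t, `|g t - f k t| <= 2 * M / 2 ^+ k * E t.
  move=> fM.
  have /choice [g gP] t : exists l, forall k, `|l - f k t| <= 2 * M / 2 ^+ k * E t.
    have [k|l lP] := @geometric_cauchy (fun k => f k t) (M * E t).
      by rewrite mulrAC.
    by exists l => k; rewrite mulrAC -[2 * M * _]mulrA.
  by exists g => k t.
have [k t|X XP] := H (fun k => (iterate k).1); first by case: (iterate_dist k t).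
have [k t|Y YP] := H (fun k => (iterate k).2); first by case: (iterate_dist k t).
by exists (X, Y).
Qed.

Let geometric_null (C e : R) : 0 <= C -> 0 < e -> exists k, C / 2 ^+ k < e.
Proof.
move=> C0 e0.
have : (fun k => C / 2 ^+ k) @ \oo --> (0 : R).
  rewrite -(mulr0 C); apply: cvgM; first exact: cvg_cst.
  under eq_fun do rewrite -exprVn.
  by apply: cvg_expr; rewrite ger0_norm // invf_lt1 // ltr1n.
move=> /cvgr_lt /(_ _ e0) [N _ HN]; exists N; exact: HN (leqnn N).
Qed.

Lemma picard : exists X Y : R -> R, [/\ X 0 = x0, Y 0 = y0,
  forall t : R, is_derive t 1 X (F1 (X t) (Y t)) &
  forall t : R, is_derive t 1 Y (F2 (X t) (Y t))].
Proof.
have [S SP] := limit_exists.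
have M2 : 0 <= 2 * M by apply: mulr_ge0 => //; exact: M0.
have cont (f : nat -> R -> R) (g : R -> R) : (forall k, continuous (f k)) ->
    (forall k t, `|g t - f k t| <= 2 * M / 2 ^+ k * E t) -> continuous g.
  move=> cf fg t; apply/cvgrPdist_le => /= e e0.
  pose B := E (`|t| + 1).
  have e3 : 0 < e / 3 by rewrite divr_gt0.
  have B0 : 0 <= B by exact: expR_ge0.
  have [||k Hk] := @geometric_null (2 * M * B) (e / 3) => //; first exact: mulr_ge0 M2 B0.
  have EB s : `|s| <= `|t| + 1 -> `|g s - f k s| <= e / 3.
    move=> st; apply: (le_trans (fg k s)); apply: le_trans (ltW Hk).
    rewrite [X in _ <= X]mulrAC; apply: ler_wpM2l.
      by apply: divr_ge0 => //; exact: exprn_ge0.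
    rewrite /B /E ler_expR; apply: ler_wpM2l; first by rewrite mulr_ge0 ?(ltW L0).
    by rewrite [X in _ <= X]ger0_norm // addr_ge0.
  near=> s.
  have fts : `|f k t - f k s| <= e / 3 by near: s; exact: cvgr_dist_le (cf k t) _ e3.
  have st : `|t - s| < 1 by near: s; exact: cvgr_dist_lt.
  have Es := EB s _; have Et := EB t _.
  have {}Es : `|g s - f k s| <= e / 3.
    by apply: Es; have := ler_normB t (t - s); rewrite opprB addrC subrK; lra.
  have {}Et : `|g t - f k t| <= e / 3 by apply: Et; lra.
  have -> : g t - g s = (g t - f k t) + (f k t - f k s) - (g s - f k s) by lra.
  apply: (le_trans (ler_normB _ _)); have := ler_normD (g t - f k t) (f k t - f k s).
  by lra.
have c1 : continuous S.1.
  by apply: (cont (fun k => (iterate k).1)) => k;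
    [case: (iterate_continuous k) | move=> t; case: (SP k t)].
have c2 : continuous S.2.
  by apply: (cont (fun k => (iterate k).2)) => k;
    [case: (iterate_continuous k) | move=> t; case: (SP k t)].
have [d1 d2] := step_derive c1 c2.
have [p1 _] := primitiveP (continuous_along LF1 c1 c2).
have [p2 _] := primitiveP (continuous_along LF2 c1 c2).
have E0 t : 0 <= E t by exact: expR_ge0.
have small (a b : R) t : (forall k, `|a - b| <= 3 * M / 2 ^+ k * E t) -> a = b.
  move=> ab; apply/eqP; rewrite -subr_eq0 -normr_le0 leNgt; apply/negP => d0.
  have [||k] := @geometric_null (3 * M * E t) `|a - b| => //.
    by apply: mulr_ge0 (E0 t); apply: mulr_ge0 => //; exact: M0.
  by rewrite mulrAC ltNge ab.
have Ck k : 0 <= 2 * M / 2 ^+ k by apply: divr_ge0 => //; exact: exprn_ge0.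
(* The limit and its Picard step are both approximated by the iterates, so they coincide: the limit
   is a fixed point. *)
have conv (F : R -> R -> R) (f : nat -> R -> R) (g h : R -> R) :
    lipschitz2 (fun _ _ => True) L F -> (forall k, f k.+1 0 = h 0) ->
    (forall k (t : R), is_derive t 1 (f k.+1) (F ((iterate k).1 t) ((iterate k).2 t))) ->
    (forall t : R, is_derive t 1 h (F (S.1 t) (S.2 t))) ->
    (forall k t, `|g t - f k t| <= 2 * M / 2 ^+ k * E t) -> g = h.
  move=> LF fh df dh fg; apply/funext => t; apply: (small _ _ t) => k.
  have := step_contracts LF (Ck k) (esym (fh k)) dh (df k) _ _ t.
  move=> /(_ (fun s => (SP k s).1) (fun s => (SP k s).2)).
  have := fg k.+1 t.
  have -> : 2 * M / 2 ^+ k.+1 = M / 2 ^+ k by rewrite exprS; field; rewrite expf_neq0.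
  have -> : 2 * M / 2 ^+ k / 2 = M / 2 ^+ k by field; rewrite expf_neq0.
  have := ler_normB (g t - f k.+1 t) (h t - f k.+1 t).
  have -> : g t - f k.+1 t - (h t - f k.+1 t) = g t - h t by lra.
  have : 0 <= M / 2 ^+ k * E t by rewrite mulr_ge0 // divr_ge0 ?exprn_ge0.
  by rewrite -[3 * M / _]mulrA -[3 * _ * E t]mulrA; lra.
have i0 k := iterate0 k.
have S1 : S.1 = (picard_step S).1.
  apply: (conv F1 (fun k => (iterate k).1)) => // [k|k t|k t].
  - by have [-> _] := i0 k.+1; rewrite /= p1 addr0.
  - by have [d _] := iterate_derive k; exact: d.
  - by case: (SP k t).
have S2 : S.2 = (picard_step S).2.
  apply: (conv F2 (fun k => (iterate k).2)) => // [k|k t|k t].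
  - by have [_ ->] := i0 k.+1; rewrite /= p2 addr0.
  - by have [_ d] := iterate_derive k; exact: d.
  - by case: (SP k t).
exists S.1, S.2; split.
- by rewrite S1 /= p1 addr0.
- by rewrite S2 /= p2 addr0.
- by move=> t; rewrite [X in is_derive _ _ X]S1; exact: d1.
- by move=> t; rewrite [X in is_derive _ _ X]S2; exact: d2.
Unshelve. all: by end_near. Qed.

End Iteration.

(** Gronwall applies to the sum of squares of the differences, which is differentiable, unlike the
    1-norm; the factor 2 pays for the passage between the two. *)
Lemma solution_gap (F1 F2 : R -> R -> R) (L : R) (X Y X' Y' : R -> R) : 0 <= L ->
  lipschitz2 (fun _ _ => True) L F1 -> lipschitz2 (fun _ _ => True) L F2 ->
  (forall t : R, is_derive t 1 X (F1 (X t) (Y t))) ->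
  (forall t : R, is_derive t 1 Y (F2 (X t) (Y t))) ->
  (forall t : R, is_derive t 1 X' (F1 (X' t) (Y' t))) ->
  (forall t : R, is_derive t 1 Y' (F2 (X' t) (Y' t))) ->
  forall t, `|X t - X' t| + `|Y t - Y' t|
    <= 2 * (`|X 0 - X' 0| + `|Y 0 - Y' 0|) * expR (2 * L * `|t|).
Proof.
move=> L0 LF1 LF2 dX dY dX' dY' t.
pose a t := X t - X' t; pose b t := Y t - Y' t.
pose a' t := F1 (X t) (Y t) - F1 (X' t) (Y' t).
pose b' t := F2 (X t) (Y t) - F2 (X' t) (Y' t).
have dW (s : R) : is_derive s 1 (fun s => a s * a s + b s * b s)
    (2 * (a s * a' s + b s * b' s)).
  have := dX s; have := dY s; have := dX' s; have := dY' s => ? ? ? ?.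
  by apply: is_derive_eq; rewrite /GRing.scale/= /a /b /a' /b'; ring.
have sq (z : R) : z * z = `|z| * `|z| by rewrite -normrM ger0_norm // -expr2 sqr_ge0.
have bnd s : `|2 * (a s * a' s + b s * b' s)| <= 4 * L * (a s * a s + b s * b s).
  have A : `|a' s| <= L * (`|a s| + `|b s|) by exact: LF1.
  have B : `|b' s| <= L * (`|a s| + `|b s|) by exact: LF2.
  rewrite normrM ger0_norm //.
  have := ler_normD (a s * a' s) (b s * b' s); rewrite !normrM.
  have A1 : `|a s| * `|a' s| <= `|a s| * (L * (`|a s| + `|b s|)) by rewrite ler_wpM2l.
  have B1 : `|b s| * `|b' s| <= `|b s| * (L * (`|a s| + `|b s|)) by rewrite ler_wpM2l.
  have AB : 0 <= L * (`|a s| - `|b s|) ^+ 2 by rewrite mulr_ge0 ?sqr_ge0.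
  rewrite (sq (a s)) (sq (b s)); move: (`|a s|) (`|b s|) (`|a' s|) (`|b' s|) A1 B1 AB => x y x' y' A1 B1 AB N.
  have -> : 4 * L * (x * x + y * y) =
    2 * (x * (L * (x + y)) + y * (L * (x + y)) + L * (x - y) ^+ 2) by ring.
  by rewrite ler_wpM2l //; lra.
have W := gronwall dW bnd 0 t; rewrite subr0 (sq (a t)) (sq (b t)) (sq (a 0)) (sq (b 0)) in W.
rewrite -/(a t) -/(b t) -/(a 0) -/(b 0).
pose E := expR (2 * L * `|t|).
have EE : expR (4 * L * `|t|) = E * E by rewrite -expRD; congr expR; ring.
rewrite EE in W; rewrite -/E.
have E0 : 0 < E by exact: expR_gt0.
set u := `|a t| in W *; set v := `|b t| in W *.
set u0 := `|a 0| in W *; set v0 := `|b 0| in W *.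
have [u1 v1 u2 v2] : [/\ 0 <= u, 0 <= v, 0 <= u0 & 0 <= v0].
  by split; exact: normr_ge0.
rewrite -ler_sqr ?nnegrE; last 2 first.
- exact: addr_ge0.
- by apply: mulr_ge0 (ltW E0); rewrite mulr_ge0 ?addr_ge0.
have -> : (u + v) ^+ 2 = 2 * (u * u + v * v) - (u - v) ^+ 2 by ring.
apply: (@le_trans _ _ (2 * (u * u + v * v))); first by rewrite gerBl sqr_ge0.
apply: (@le_trans _ _ (2 * ((u0 * u0 + v0 * v0) * (E * E)))); first by rewrite ler_wpM2l.
have -> : (2 * (u0 + v0) * E) ^+ 2 = 4 * (u0 + v0) ^+ 2 * (E * E) by ring.
rewrite mulrA ler_wpM2r ?mulr_ge0 ?(ltW E0) //.
have -> : 4 * (u0 + v0) ^+ 2 =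
  2 * (u0 * u0 + v0 * v0) + (2 * (u0 * u0) + 2 * (v0 * v0) + 8 * (u0 * v0)) by ring.
by rewrite lerDl !addr_ge0 // !mulr_ge0.
Qed.

End Picard.

(** * Connections of planar systems *)

Section PlanarConnection.
Context {R : realType}.

Definition clamp (a b x : R) := Num.max a (Num.min x b).

Lemma clamp_itv a b x : a <= b -> a <= clamp a b x <= b.
Proof. by move=> ab; rewrite /clamp le_max lexx ge_max ab ge_min lexx orbT. Qed.

Lemma clamp_id a b x : a <= x <= b -> clamp a b x = x.
Proof. by move=> /andP[ax xb]; rewrite /clamp (min_idPl xb) (max_idPr ax). Qed.

Lemma clamp_dist a b x y : a <= b -> `|clamp a b x - clamp a b y| <= `|x - y|.
Proof.
move=> ab; rewrite /clamp.
have := ler_norm (x - y); have := ler_norm (y - x); rewrite (distrC y x).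
case: (leP x b) => xb; case: (leP y b) => yb;
  rewrite ?(max_idPr ab); try case: (leP a x) => ax; try case: (leP a y) => ay => ? ?;
  by rewrite ler_norml; apply/andP; split; lra.
Qed.

Lemma linear_unbounded (a b : R) : 0 < a -> exists2 t, 0 <= t & b < a * t.
Proof.
move=> a0; exists ((`|b| + 1) / a); first by rewrite divr_ge0 ?addr_ge0 // ltW.
by rewrite mulrC divfK ?gt_eqF //; have := ler_norm b; lra.
Qed.

(** [s] and [T] are the abscissae of source and target. The cone, of slope [kappa], is used only up
    to [m]; beyond [m] the drift [p] itself pushes to the right, and beyond [m2] the variable [y]
    decays. [c] measures the drift, [f0] the push and [gamma] the rates of [y]. *)
Variables (p : R -> R) (f g : R -> R -> R) (s m m2 T kappa gamma f0 c C : R).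

Definition planar_box (B x y : R) := (s <= x <= T) /\ (0 <= y <= B).

Hypotheses (sm : s < m) (mm2 : m < m2) (m2T : m2 < T).
Hypotheses (kappa0 : 0 < kappa) (gamma0 : 0 < gamma) (f00 : 0 < f0) (C0 : 0 <= C).
Hypotheses (cgamma : 2 * c < gamma) (cf0 : 2 * c <= kappa * f0).
Hypotheses (cp : continuous p) (pT : p T = 0).
Hypothesis p_near_s : forall x, s <= x <= m -> `|p x| <= c * (x - s).
Hypothesis p_ge0 : 0 <= p m.
Hypothesis p_gt0 : forall x, m < x < T -> 0 < p x.
Hypothesis cone_f : forall x y, s <= x <= m -> 0 <= y -> kappa * (x - s) <= y -> f0 <= f x y.
Hypothesis cone_g : forall x y, s <= x <= m -> 0 <= y -> kappa * (x - s) <= y -> gamma <= g x y.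
(** On the edge of the cone [y] grows at least at rate [gamma * y]. One half of this pays for the
    push [kappa * y * f], the other half, by [cgamma], for the drift. *)
Hypothesis cone_edge :
  forall x, s <= x <= m -> 2 * (kappa * f x (kappa * (x - s))) <= gamma.
Hypothesis f_m : forall y, 0 < y -> 0 < f m y.
Hypothesis f_ge0 : forall x y, m <= x <= T -> 0 <= y -> 0 <= f x y.
Hypothesis f_T : forall y, f T y = 0.
(** The factor [1 + y] admits a [g] that is quadratic in [y] beside an [f] that is linear in [y], as
    for the labels 3 and 4. *)
Hypothesis growth1 : forall x y, s <= x <= m -> 1 <= y -> kappa * (x - s) <= y ->
  g x y <= C * (1 + y) * f x y.
Hypothesis growth2 : forall x y, m <= x <= m2 -> 1 <= y -> g x y <= C * (1 + y) * f x y.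
Hypothesis sink : forall x y, m2 <= x <= T -> 0 <= y -> g x y <= - gamma.
Hypothesis box_lipschitz : forall B, 0 < B -> exists L, [/\ 0 < L,
  lipschitz2 (planar_box B) L (fun x y => p x + y * f x y) &
  lipschitz2 (planar_box B) L (fun x y => y * g x y)].

Let sT : s < T. Proof. exact: lt_trans (lt_trans sm mm2) m2T. Qed.

Let mT : m < T. Proof. exact: lt_trans mm2 m2T. Qed.

(** The 2 is the value of [1 + y] at the last time with [y = 1]. In [B], the summand
    [kappa * (m - s)] ensures that truncation at height [B] does not move points out of the cone. *)
Let Ymax := 2 * expR (2 * C * (T - s)).
Let B := Ymax + kappa * (m - s) + 1.

Let Ymax2 : 2 <= Ymax.
Proof.
have : 1 + 2 * C * (T - s) <= expR (2 * C * (T - s)) by exact: expR_ge1Dx.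
have : 0 <= 2 * C * (T - s) by rewrite !mulr_ge0 // subr_ge0 ltW.
by rewrite /Ymax; lra.
Qed.

Let km0 : 0 < kappa * (m - s). Proof. by rewrite mulr_gt0 // subr_gt0. Qed.

Let B1 : 1 <= B. Proof. by rewrite /B; have := Ymax2; have := km0; lra. Qed.

(** Truncated coordinates turn the field into a globally Lipschitz one that is unchanged in the box;
    [orbit_dX] and [orbit_dY] remove the truncation afterwards. *)
Let cx := clamp s T.
Let cy := clamp 0 B.
Let V x y := p (cx x) + cy y * f (cx x) (cy y).
Let G x y := cy y * g (cx x) (cy y).

Let cxP x : s <= cx x <= T. Proof. by apply: clamp_itv; exact: ltW. Qed.
Let cyP y : 0 <= cy y <= B. Proof. by apply: clamp_itv; have := B1; lra. Qed.
Let cx_id x : s <= x <= T -> cx x = x. Proof. exact: clamp_id. Qed.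
Let cy_id y : 0 <= y <= B -> cy y = y. Proof. exact: clamp_id. Qed.

Let cy_gt0 y : 0 < y -> 0 < cy y.
Proof.
by move=> y0; rewrite /cy /clamp lt_max lt_min y0 (lt_le_trans ltr01 B1) orbT.
Qed.

Let cy_le y : 0 <= y -> cy y <= y.
Proof. by move=> y0; rewrite /cy /clamp ge_max y0 ge_min lexx. Qed.

Let cy_ge1 y : 1 <= y -> 1 <= cy y.
Proof. by move=> y1; rewrite /cy /clamp le_max le_min y1 B1 orbT. Qed.

Let clamped_lipschitz : exists L, [/\ 0 < L,
  lipschitz2 (fun _ _ => True) L V & lipschitz2 (fun _ _ => True) L G].
Proof.
have [L [L0 LV LG]] := box_lipschitz (lt_le_trans ltr01 B1).
exists L; split=> // x y x' y' _ _.
  apply: le_trans (LV _ _ _ _ (conj (cxP x) (cyP y)) (conj (cxP x') (cyP y'))) _.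
  rewrite ler_wpM2l ?(ltW L0) // lerD // clamp_dist //; first exact: ltW.
  by have := B1; lra.
apply: le_trans (LG _ _ _ _ (conj (cxP x) (cyP y)) (conj (cxP x') (cyP y'))) _.
rewrite ler_wpM2l ?(ltW L0) // lerD // clamp_dist //; first exact: ltW.
by have := B1; lra.
Qed.

Let GY0 x : G x 0 = 0.
Proof. by rewrite /G cy_id ?mul0r //; have := B1; lra. Qed.

Let VT y : V T y = 0.
Proof. by rewrite /V cx_id ?pT ?f_T ?mulr0 ?addr0 // lexx (ltW sT). Qed.

Let cone_cy x y : s <= x <= m -> kappa * (x - s) <= y -> kappa * (x - s) <= cy y.
Proof.
move=> /andP[sx xm] xy; rewrite /cy /clamp le_max le_min xy /=; apply/orP; right.
have : kappa * (x - s) <= kappa * (m - s) by rewrite ler_pM2l // lerB.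
by rewrite /B; have := Ymax2; lra.
Qed.

(** In the cone the drift is at most [c * (x - s)], which by [cf0] consumes at most half of the
    push; hence the factor 2. *)
Let V_cone x y : s <= x <= m -> 0 < y -> kappa * (x - s) <= y ->
  cy y * f x (cy y) <= 2 * V x y /\ 0 < V x y.
Proof.
move=> xsm y0 xy; have [sx xm] := andP xsm.
have k := cone_cy xsm xy; have c0 := cy_gt0 y0.
have ff := cone_f xsm (ltW c0) k.
have pp := p_near_s xsm; rewrite ler_norml in pp; have [pp1 _] := andP pp.
rewrite /V cx_id ?sx ?(le_trans xm (ltW mT)) //.
have : 2 * (c * (x - s)) <= cy y * f0.
  have : (kappa * (x - s)) * f0 <= cy y * f0 by rewrite ler_wpM2r // ltW.
  have : 2 * c * (x - s) <= kappa * f0 * (x - s) by rewrite ler_wpM2r // subr_ge0.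
  by lra.
have : cy y * f0 <= cy y * f x (cy y) by rewrite ler_pM2l.
have : 0 < cy y * f0 by rewrite mulr_gt0.
by split; lra.
Qed.

Let V_right x y : m <= x < T -> 0 < y -> cy y * f x (cy y) <= V x y /\ 0 < V x y.
Proof.
move=> /andP[mx xT] y0; have c0 := cy_gt0 y0.
rewrite /V cx_id ?(ltW xT) ?andbT ?(le_trans (ltW sm)) //.
have ff : 0 <= f x (cy y) by apply: f_ge0; rewrite ?mx ltW.
move: mx; rewrite le_eqVlt => /predU1P[<-|mx].
  have : 0 < cy y * f m (cy y) by rewrite mulr_gt0 // f_m.
  by have := p_ge0; split; lra.
have : 0 < p x by apply: p_gt0; rewrite mx.
have : 0 <= cy y * f x (cy y) by rewrite mulr_ge0 // ltW.
by split; lra.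
Qed.

(** * A single orbit that starts in the cone *)

Section Orbit.
Variables X Y : R -> R.
Hypotheses (dX : forall t : R, is_derive t 1 X (V (X t) (Y t)))
  (dY : forall t : R, is_derive t 1 Y (G (X t) (Y t))).
Hypotheses (X0 : s <= X 0 <= m) (Y0 : 0 < Y 0) (Y1 : Y 0 <= 1)
  (XY0 : kappa * (X 0 - s) <= Y 0).

Lemma orbit_Y t : 0 < Y t.
Proof.
have [L [L0 _ LG]] := clamped_lipschitz.
apply: (stays_pos (K := L) dY) Y0 _ => r.
have := LG (X r) (Y r) (X r) 0 I I.
by rewrite GY0 !subr0 subrr normr0 add0r.
Qed.

(** The line [x = T] is invariant, as both the drift and [f] vanish there. *)
Lemma orbit_XT t : X t < T.
Proof.
have [L [L0 LV _]] := clamped_lipschitz.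
have d (r : R) : is_derive r 1 (fun r => T - X r) (- V (X r) (Y r)).
  exact: is_derive_eq (is_deriveB (is_derive_cst T r 1) (dX r)) (sub0r _).
rewrite -subr_gt0; suff : forall r, `|- V (X r) (Y r)| <= L * `|T - X r|.
  move=> /(stays_pos d) /(_ 0); apply.
  by rewrite subr_gt0; case/andP: X0 => _ /le_lt_trans; apply; exact: mT.
move=> r; have := LV (X r) (Y r) T (Y r) I I.
by rewrite VT subrr normr0 addr0 normrN subr0 (distrC T).
Qed.

Lemma orbit_sX t : 0 <= t -> s <= X t.
Proof.
move=> t0; apply: (stays_ge dX t0); last by case/andP: X0.
move=> r _ Xs; rewrite /V.
have -> : cx (X r) = s by rewrite /cx /clamp (min_idPl (ltW (orbit_XT r))) (max_idPl (ltW Xs)).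
have sm' : s <= s <= m by rewrite lexx ltW.
have c0 := cy_gt0 (orbit_Y r).
have := p_near_s sm'; rewrite subrr mulr0 normr_le0 => /eqP ->; rewrite add0r.
rewrite mulr_ge0 ?(ltW c0) //; apply: le_trans (ltW f00) _.
by apply: cone_f => //; rewrite ?subrr ?mulr0 ltW.
Qed.

Lemma orbit_level a b l : m <= l -> a <= b -> l <= X a -> l <= X b.
Proof.
move=> ml ab lX.
have lT : l < T by apply: le_lt_trans (orbit_XT a).
apply: (upcrossing dX ab _ lX) => t _ Xt.
by apply: (V_right _ (orbit_Y t)).2; rewrite Xt ml.
Qed.

Lemma orbit_cone t : 0 <= t -> X t <= m -> kappa * (X t - s) <= Y t.
Proof.
move=> t0 Xm; rewrite -subr_ge0 leNgt; apply/negP => neg.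
pose u r := Y r - kappa * (X r - s).
have du (r : R) : is_derive r 1 u (G (X r) (Y r) - kappa * V (X r) (Y r)).
  have := dX r; have := dY r => ? ?.
  by apply: is_derive_eq; rewrite /GRing.scale/=; ring.
have cu : continuous u by move=> r; exact: is_derive_continuous (du r).
have u0 : 0 <= u 0 by rewrite /u subr_ge0.
have [r [/andP[r0 rt] ur after]] := last_crossing cu t0 u0 neg.
(* An orbit beyond [m] cannot come back, so this crossing of the edge takes place where the cone
   hypotheses apply. *)
have [Xr|Xr] := leP (X r) m; last first.
  have := orbit_level (ltW Xr) (ltW rt) (lexx _).
  by rewrite leNgt (le_lt_trans Xm Xr).
have sX := orbit_sX r0.
have sXm : s <= X r <= m by rewrite sX.
have Yr : Y r = kappa * (X r - s) by move: ur; rewrite /u; lra.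
have YB : cy (Y r) = Y r.
  apply: cy_id; rewrite (ltW (orbit_Y r)) Yr /=.
  have : kappa * (X r - s) <= kappa * (m - s) by rewrite ler_pM2l // lerB.
  by rewrite /B; have := Ymax2; lra.
have pos : 0 < G (X r) (Y r) - kappa * V (X r) (Y r).
  rewrite /G /V YB cx_id ?sX ?(ltW (orbit_XT r)) //.
  have y0 := orbit_Y r.
  have gg : Y r * gamma <= Y r * g (X r) (Y r).
    by rewrite ler_pM2l // cone_g // ?Yr ?lexx // -Yr ltW.
  have pp := p_near_s sXm; rewrite ler_norml in pp; have [_ pp1] := andP pp.
  have kp : kappa * p (X r) <= c * Y r.
    by rewrite Yr mulrCA ler_pM2l.
  have kf : 2 * (kappa * (Y r * f (X r) (Y r))) <= Y r * gamma.
    have := cone_edge sXm; rewrite -Yr => H.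
    have : Y r * (2 * (kappa * f (X r) (Y r))) <= Y r * gamma by rewrite ler_pM2l.
    by lra.
  have cY : 2 * (c * Y r) < Y r * gamma.
    by rewrite mulrA mulrC ltr_pM2l.
  by lra.
have [q qt] := derive_pos_increases (du r) pos rt.
by rewrite ur ltNge => /negP; apply; exact: ltW (after q qt).
Qed.

Lemma orbit_V t : 0 <= t -> 0 < V (X t) (Y t).
Proof.
move=> t0; have [Xm|mX] := leP (X t) m.
  by apply: (V_cone _ (orbit_Y t) (orbit_cone t0 Xm)).2; rewrite orbit_sX.
by apply: (V_right _ (orbit_Y t)).2; rewrite ltW ?orbit_XT.
Qed.

Lemma orbit_mono a b : 0 <= a -> a <= b -> X a <= X b.
Proof.
move=> a0 ab; apply: (derive_ge0_le dX ab) => t /andP[at_ _].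
by apply/ltW/orbit_V; rewrite (le_trans a0) // ltW.
Qed.

Lemma orbit_bound t : 0 <= t -> Y t < Ymax.
Proof.
move=> t0; rewrite ltNge; apply/negP => big.
have cN : continuous (fun r => - Y r).
  by move=> r; apply: is_derive_continuous; have := dY r => ?; exact: is_deriveN.
have [||r [/andP[r0 rt] Yr after]] := last_crossing (l := -1) cN t0.
- by rewrite lerN2.
- by rewrite ltrN2; have := Ymax2; lra.
have {}Yr : Y r = 1 by apply: oppr_inj.
pose Z q := - ((1 + Y q) * expR (- (2 * C) * (X q - X r))).
have dZ (q : R) : is_derive q 1 Z (expR (- (2 * C) * (X q - X r)) *
    (2 * C * (1 + Y q) * V (X q) (Y q) - G (X q) (Y q))).
  have := dX q; have := dY q => ? ?.
  by apply: is_derive_eq; rewrite /GRing.scale/=; ring.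
have : Z r <= Z t.
  apply: (derive_ge0_le dZ (ltW rt)) => q /andP[rq qt].
  have q0 : 0 <= q by rewrite (le_trans r0) // ltW.
  have Yq : 1 < Y q by have := after q; rewrite ltrN2; apply; rewrite rq ltW.
  rewrite mulr_ge0 ?expR_ge0 // subr_ge0.
  have c1 := cy_ge1 (ltW Yq); have c0 := lt_le_trans ltr01 c1.
  have cq := cy_le (ltW (orbit_Y q)).
  have Vq := orbit_V q0; have sX := orbit_sX q0; have XT := ltW (orbit_XT q).
  have CV : 0 <= C * (1 + Y q) * V (X q) (Y q).
    by rewrite !mulr_ge0 ?(ltW Vq) // addr_ge0 // ltW // orbit_Y.
  rewrite {1}/G cx_id ?sX //.
  have main k : cy (Y q) * f (X q) (cy (Y q)) <= k -> 0 <= f (X q) (cy (Y q)) ->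
      g (X q) (cy (Y q)) <= C * (1 + cy (Y q)) * f (X q) (cy (Y q)) ->
      cy (Y q) * g (X q) (cy (Y q)) <= C * (1 + Y q) * k.
    move=> fk fge gle.
    apply: (@le_trans _ _ (cy (Y q) * (C * (1 + cy (Y q)) * f (X q) (cy (Y q))))).
      by rewrite ler_pM2l.
    apply: (@le_trans _ _ (C * (1 + cy (Y q)) * k)).
      by rewrite mulrCA ler_wpM2l // mulr_ge0 // addr_ge0 // ltW.
    rewrite ler_wpM2r ?ler_wpM2l ?lerD //.
    by apply: le_trans fk; rewrite mulr_ge0 // ltW.
  have [Xm|mX] := leP (X q) m.
    have sXm : s <= X q <= m by rewrite sX.
    have cone := orbit_cone q0 Xm; have ccone := cone_cy sXm cone.
    have [VV _] := V_cone sXm (orbit_Y q) cone.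
    have -> : 2 * C * (1 + Y q) * V (X q) (Y q) = C * (1 + Y q) * (2 * V (X q) (Y q)) by ring.
    apply: main VV _ (growth1 sXm c1 ccone).
    by apply: le_trans (ltW f00) _; apply: cone_f => //; exact: ltW.
  have mXT : m <= X q < T by rewrite ltW ?orbit_XT.
  have [VV _] := V_right mXT (orbit_Y q).
  have [Xm2|m2X] := leP (X q) m2.
    apply: (@le_trans _ _ (C * (1 + Y q) * V (X q) (Y q))); last by lra.
    apply: main VV _ _; last by apply: growth2 => //; rewrite ltW.
    by apply: f_ge0; rewrite ?XT ?andbT ltW.
  apply: (@le_trans _ _ 0); last by lra.
  rewrite mulr_ge0_le0 ?(ltW c0) //.
  have : g (X q) (cy (Y q)) <= - gamma by apply: sink; rewrite ?XT ?andbT ltW.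
  by have := gamma0; lra.
rewrite /Z subrr mulr0 expR0 mulr1 lerN2 Yr => HZ.
have : 1 + Y t <= 2 * expR (2 * C * (X t - X r)).
  by move: HZ; rewrite mulNr expRN ler_pdivrMr ?expR_gt0.
have : expR (2 * C * (X t - X r)) <= expR (2 * C * (T - s)).
  rewrite ler_expR ler_wpM2l ?mulr_ge0 // lerB ?orbit_sX //.
  exact: ltW (orbit_XT t).
by move: big; rewrite /Ymax; lra.
Qed.

Lemma orbit_dX t : 0 <= t -> V (X t) (Y t) = p (X t) + Y t * f (X t) (Y t).
Proof.
move=> t0; rewrite /V cx_id ?cy_id ?orbit_sX ?(ltW (orbit_XT t)) //.
rewrite (ltW (orbit_Y t)) /=; apply: le_trans (ltW (orbit_bound t0)) _.
by rewrite /B; have := km0; lra.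
Qed.

Lemma orbit_dY t : 0 <= t -> G (X t) (Y t) = Y t * g (X t) (Y t).
Proof.
move=> t0; rewrite /G cx_id ?cy_id ?orbit_sX ?(ltW (orbit_XT t)) //.
rewrite (ltW (orbit_Y t)) /=; apply: le_trans (ltW (orbit_bound t0)) _.
by rewrite /B; have := km0; lra.
Qed.

Lemma orbit_growth a b : 0 <= a -> a <= b -> X b <= m ->
  Y a * expR (gamma * (b - a)) <= Y b.
Proof.
move=> a0 ab Xb.
pose u r := Y r * expR (- gamma * (r - a)).
have du (r : R) : is_derive r 1 u (expR (- gamma * (r - a)) * (G (X r) (Y r) - gamma * Y r)).
  have := dY r => ?.
  by apply: is_derive_eq; rewrite /GRing.scale/=; ring.
have : u a <= u b.
  apply: (derive_ge0_le du ab) => r /andP[ar rb].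
  have r0 : 0 <= r by rewrite (le_trans a0) // ltW.
  have Xr : X r <= m by apply: le_trans Xb; apply: orbit_mono => //; exact: ltW.
  rewrite mulr_ge0 ?expR_ge0 // orbit_dY // subr_ge0 mulrC ler_pM2l ?orbit_Y //.
  apply: cone_g; [by rewrite orbit_sX | exact: ltW (orbit_Y r) | exact: orbit_cone].
by rewrite /u subrr mulr0 expR0 mulr1 mulNr expRN ler_pdivlMr ?expR_gt0.
Qed.

Lemma orbit_decay a b : 0 <= a -> a <= b -> m2 <= X a ->
  Y b <= Y a * expR (- gamma * (b - a)).
Proof.
move=> a0 ab Xa.
pose u r := - (Y r * expR (gamma * (r - a))).
have du (r : R) : is_derive r 1 u (expR (gamma * (r - a)) * (- G (X r) (Y r) - gamma * Y r)).
  have := dY r => ?.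
  by apply: is_derive_eq; rewrite /GRing.scale/=; ring.
have : u a <= u b.
  apply: (derive_ge0_le du ab) => r /andP[ar rb].
  have r0 : 0 <= r by rewrite (le_trans a0) // ltW.
  have Xr : m2 <= X r by apply: le_trans Xa _; apply: orbit_mono => //; exact: ltW.
  rewrite mulr_ge0 ?expR_ge0 // orbit_dY // -mulrN -[gamma * _]mulrC -mulrBr.
  rewrite mulr_ge0 ?(ltW (orbit_Y r)) // subr_ge0 lerNr.
  by apply: sink; rewrite ?Xr ?ltW ?orbit_XT ?orbit_Y.
rewrite /u subrr mulr0 expR0 mulr1 lerN2 mulNr expRN ler_pdivlMr ?expR_gt0 //.
Qed.

Lemma orbit_passes : exists2 t, 0 <= t & m < X t.
Proof.
have [t t0 tb] := @linear_unbounded (Y 0 * gamma) Ymax (mulr_gt0 Y0 gamma0).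
exists t => //; rewrite ltNge; apply/negP => Xm.
have := orbit_growth (lexx 0) t0 Xm; rewrite subr0 leNgt => /negP; apply.
apply: lt_trans (orbit_bound t0) _; apply: lt_le_trans tb _.
rewrite -mulrA ler_pM2l //; have := expR_ge1Dx (gamma * t); lra.
Qed.

(** If [X] stayed below [T - e] after passing [m], the drift would be bounded below by a positive
    minimum and [X] would grow linearly. *)
Lemma orbit_X_cvg : X t @[t --> +oo] --> T.
Proof.
apply/cvgrPdist_le => /= e e0.
have [t1 t10 Xt1] := orbit_passes.
have [t2 t20 Xt2] : exists2 t, t1 <= t & T - e <= X t.
  apply: contrapT => /forall2NP H.
  have low t : t1 <= t -> X t < T - e.
    by move=> t1t; have [//|/negP] := H t; rewrite ltNge.
  have ab : X t1 <= T - e by exact: ltW (low _ (lexx _)).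
  have [|z + pz] := EVT_min ab (f := p); first exact: continuous_subspaceT.
  rewrite in_itv/= => /andP[zl zr].
  have p0 : 0 < p z by apply: p_gt0; rewrite (lt_le_trans Xt1 zl) /=; move: zr e0; lra.
  have [r r0 rb] := linear_unbounded (T - e - X t1) p0.
  have t1r : t1 <= t1 + r by rewrite lerDl.
  pose u q := X q - p z * (q - t1).
  have du (q : R) : is_derive q 1 u (V (X q) (Y q) - p z).
    have := dX q => ?.
    by apply: is_derive_eq; rewrite /GRing.scale/=; ring.
  have : u t1 <= u (t1 + r).
    apply: (derive_ge0_le du t1r) => q /andP[tq _].
    have q0 : 0 <= q by rewrite (le_trans t10) // ltW.
    have XX : X t1 <= X q by apply: orbit_mono => //; exact: ltW.
    have mX : m <= X q < T by rewrite orbit_XT andbT (le_trans (ltW Xt1)).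
    have c0 := cy_gt0 (orbit_Y q).
    have : 0 <= cy (Y q) * f (X q) (cy (Y q)).
      rewrite mulr_ge0 ?(ltW c0) // f_ge0 ?(ltW c0) //.
      by case/andP: mX => -> /ltW.
    have : p z <= p (X q) by apply: pz; rewrite in_itv/= XX ltW // low // ltW.
    by rewrite /V cx_id ?orbit_sX ?(ltW (orbit_XT q)) //; lra.
  have := low _ t1r; rewrite /u subrr mulr0 addrAC subrr add0r; lra.
near=> t.
have t2t : t2 <= t by near: t; apply: nbhs_pinfty_ge; exact: num_real.
have : X t2 <= X t := orbit_mono (le_trans t10 t20) t2t.
have XT := orbit_XT t; rewrite ger0_norm ?subr_ge0 ?(ltW XT) //; lra.
Unshelve. all: by end_near. Qed.

Lemma orbit_Y_cvg : Y t @[t --> +oo] --> (0 : R).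
Proof.
have [t1 t10 Xt1] : exists2 t, 0 <= t & m2 <= X t.
  have e0 : 0 < T - m2 by rewrite subr_gt0.
  have /cvgrPdist_le /(_ _ e0) [M [_ HM]] := orbit_X_cvg.
  exists (`|M| + 1); first by rewrite addr_ge0.
  have /HM /= : M < `|M| + 1 by have := ler_norm M; lra.
  by have := ler_norm (T - X (`|M| + 1)); lra.
apply/cvgrPdist_le => /= e e0.
have [r r0 rb] := linear_unbounded (Y t1) (mulr_gt0 e0 gamma0).
near=> t.
have t2t : t1 + r <= t by near: t; apply: nbhs_pinfty_ge; exact: num_real.
have t1t : t1 <= t by lra.
rewrite sub0r normrN gtr0_norm ?orbit_Y //.
apply: le_trans (orbit_decay t10 t1t Xt1) _.
rewrite mulNr expRN ler_pdivrMr ?expR_gt0 //; apply: le_trans (ltW rb) _.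
rewrite -mulrA ler_pM2l //.
have : gamma * r <= gamma * (t - t1) by rewrite ler_pM2l //; lra.
by have := expR_ge1Dx (gamma * (t - t1)); lra.
Unshelve. all: by end_near. Qed.

End Orbit.

(** Below [kappa * (m - s)], so that an orbit in the cone reaches the height [delta] no later than
    [x = m]; at most 1, as [orbit_bound] demands of the initial height. *)
Let delta := Num.min 1 (kappa * (m - s) / 2).

Let delta_gt0 : 0 < delta.
Proof. by rewrite lt_min ltr01 divr_gt0. Qed.

Let delta_le1 : delta <= 1.
Proof. by rewrite ge_min lexx. Qed.

Let delta_lt : delta < kappa * (m - s).
Proof.
have : delta <= kappa * (m - s) / 2 by rewrite ge_min lexx orbT.
by have := km0; lra.
Qed.

(** The lower an orbit starts above the source, the longer it takes to the section [y = delta]. With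
    time reset there, the cone and the growth of [y] control it on a long interval of negative
    times. *)
Lemma section_orbit (N : R) : exists X Y : R -> R, [/\
  forall t : R, is_derive t 1 X (V (X t) (Y t)),
  forall t : R, is_derive t 1 Y (G (X t) (Y t)),
  Y 0 = delta, s <= X 0 <= m &
  forall r, - N <= r <= 0 -> [/\ s <= X r, kappa * (X r - s) <= Y r &
    Y r <= delta * expR (gamma * r)]].
Proof.
have [L [L0 LV LG]] := clamped_lipschitz.
(* [y] grows at most at rate [L], so from the height [eta] it needs at least the time [N] to reach
   [delta]. *)
pose eta := delta * expR (- (L * (`|N| + 1))).
have eta0 : 0 < eta by rewrite mulr_gt0 ?expR_gt0.
have etad : eta < delta.
  rewrite gtr_pMr // expR_lt1 oppr_lt0.
  by rewrite mulr_gt0 // ltr_wpDl.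
have [X [Y [X0 Y0 dX dY]]] := picard s eta L0 LV LG.
have hX0 : s <= X 0 <= m by rewrite X0 lexx ltW.
have hY0 : 0 < Y 0 by rewrite Y0.
have hY1 : Y 0 <= 1 by rewrite Y0; apply: le_trans (ltW etad) _.
have hXY : kappa * (X 0 - s) <= Y 0 by rewrite X0 subrr mulr0 ltW.
have mono := orbit_mono dX dY hX0 hY0 hXY.
have cone := orbit_cone dX dY hX0 hY0 hXY.
have [t1 t10 Xt1] := orbit_passes dX dY hX0 hY0 hY1 hXY.
have [|t2 /andP[t20 _] Xt2] := ivt (v := m) dX t10.
  by rewrite X0 ge_min le_max (ltW sm) (ltW Xt1) orbT.
have [|tau /andP[tau0 taut] Ytau] := ivt (v := delta) dY t20.
  rewrite Y0 ge_min le_max (ltW etad) /=; apply/orP; right.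
  have := cone t2 t20; rewrite Xt2 lexx => /(_ isT); apply: le_trans.
  exact: ltW.
have Xtau : X tau <= m by rewrite -Xt2 mono.
have tauN : N <= tau.
  have Yb r : `|G (X r) (Y r)| <= L * Y r.
    have := LG (X r) (Y r) (X r) 0 I I.
    by rewrite GY0 !subr0 subrr normr0 add0r (gtr0_norm (orbit_Y dY hY0 r)).
  have := gronwall dY Yb 0 tau; rewrite Ytau Y0 subr0 ger0_norm // /eta.
  rewrite -mulrA -expRD -[X in X <= _]mulr1 ler_pM2l // -[leLHS]expR0 ler_expR.
  rewrite addrC subr_ge0 ler_pM2l //; have := ler_norm N; lra.
have sh (r : R) : is_derive r 1 (fun r => tau + r) 1.
  exact: is_derive_eq (is_deriveD (is_derive_cst tau r 1) (is_derive_id r 1)) (add0r _).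
exists (fun r => X (tau + r)), (fun r => Y (tau + r)); split.
- move=> t; have := is_derive1_comp (f := X) (g := fun r => tau + r) (x := t).
  by move=> /(_ _ _ (dX _) (sh t)) H; apply: is_derive_eq H _; rewrite mulr1.
- move=> t; have := is_derive1_comp (f := Y) (g := fun r => tau + r) (x := t).
  by move=> /(_ _ _ (dY _) (sh t)) H; apply: is_derive_eq H _; rewrite mulr1.
- by rewrite addr0.
- by rewrite addr0 Xtau andbT (orbit_sX dX dY hX0 hY0).
move=> r /andP[Nr r0].
have t0 : 0 <= tau + r by lra.
have tt : tau + r <= tau by lra.
have Xr : X (tau + r) <= m by apply: le_trans (mono _ _ t0 tt) Xtau.
split; [exact: (orbit_sX dX dY hX0 hY0) | exact: cone |].
have := orbit_growth dX dY hX0 hY0 hY1 hXY t0 tt Xtau.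
rewrite Ytau -ler_pdivlMr ?expR_gt0 // -expRN.
by have -> : - (gamma * (tau - (tau + r))) = gamma * r by ring.
Qed.

Lemma planar_connection : exists X Y : R -> R, [/\
  forall t : R, is_derive t 1 X (p (X t) + Y t * f (X t) (Y t)),
  forall t : R, is_derive t 1 Y (Y t * g (X t) (Y t)),
  forall t, 0 < Y t,
  X t @[t --> -oo] --> s /\ Y t @[t --> -oo] --> (0 : R) &
  X t @[t --> +oo] --> T /\ Y t @[t --> +oo] --> (0 : R)].
Proof.
have [L [L0 LV LG]] := clamped_lipschitz.
have /choice [S SP] (k : nat) : exists S : (R -> R) * (R -> R), [/\
    forall t : R, is_derive t 1 S.1 (V (S.1 t) (S.2 t)),
    forall t : R, is_derive t 1 S.2 (G (S.1 t) (S.2 t)),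
    S.2 0 = delta, s <= S.1 0 <= m &
    forall r, - k%:R <= r <= 0 -> [/\ s <= S.1 r, kappa * (S.1 r - s) <= S.2 r &
      S.2 r <= delta * expR (gamma * r)]].
  by have [X [Y H]] := section_orbit k%:R; exists (X, Y).
pose q k := (S k).1 0.
have qsm : (q @ \oo) [set` `[s, m]].
  by exists 0%N => // k _; rewrite /= in_itv/=; case: (SP k).
(* The orbits cross the section in a compact segment; the solution through a cluster point of the
   crossings will be the connection. *)
have [x0 [+ clx]] := @segment_compact R s m (q @ \oo) _ qsm.
rewrite /= in_itv/= => x0sm.
have near_x0 e N : 0 < e -> exists2 k, (N <= k)%N & `|q k - x0| < e.
  move=> e0.
  have QN : (q @ \oo) [set q k | k in [set k | (N <= k)%N]].
    by exists N => // k Nk; exists k.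
  have [y [[k Nk <-] xy]] := clx _ _ QN (nbhsx_ballx x0 e e0).
  by exists k; rewrite // distrC.
have [X [Y [X0 Y0 dX dY]]] := picard x0 delta L0 LV LG.
have approx r e : 0 < e -> r <= 0 -> exists k, [/\ - k%:R <= r,
    `|(S k).1 r - X r| <= e & `|(S k).2 r - Y r| <= e].
  move=> e0 r0.
  pose E := 2 * expR (2 * L * `|r|).
  have E0 : 0 < E by rewrite mulr_gt0 ?expR_gt0.
  have [k Nk qk] := near_x0 (e / E) (Num.truncn `|r|).+1 (divr_gt0 e0 E0).
  have [dS1 dS2 S0 _ _] := SP k.
  have := solution_gap (ltW L0) LV LG dS1 dS2 dX dY r.
  rewrite S0 Y0 subrr normr0 addr0 X0 -/(q k).
  rewrite mulrAC -/E => gap.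
  have {}gap : `|(S k).1 r - X r| + `|(S k).2 r - Y r| <= e.
    apply: (le_trans gap); rewrite mulrC -ler_pdivlMr //; exact: ltW.
  exists k; split; last 2 first.
  - by apply: le_trans gap; rewrite lerDl.
  - by apply: le_trans gap; rewrite lerDr.
  have : `|r| < k%:R.
    by apply: lt_le_trans (truncnS_gt _) _; rewrite ler_nat.
  by rewrite ler0_norm //; lra.
(* The next three estimates are closed conditions and pass to the limit by continuous dependence on
   the initial point. *)
have le_eps (a b k : R) : 0 < k -> (forall e, 0 < e -> a <= b + k * e) -> a <= b.
  move=> k0 H; apply/ler_addgt0Pr => e e0; have := H (e / k) (divr_gt0 e0 k0).
  by rewrite mulrC divfK ?gt_eqF.
have sX r : r <= 0 -> s <= X r.
  move=> r0; apply: (le_eps _ _ 1 ltr01) => e e0.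
  have [k [kr kX kY]] := approx _ _ e0 r0; have [_ _ _ _ /(_ r)] := SP k.
  rewrite kr r0 => /(_ isT) [? _ _]; have := ler_norm ((S k).1 r - X r); lra.
have YX r : r <= 0 -> kappa * (X r - s) <= Y r.
  move=> r0; apply: (le_eps _ _ (1 + kappa)); first by rewrite addr_gt0.
  move=> e e0.
  have [k [kr kX kY]] := approx _ _ e0 r0; have [_ _ _ _ /(_ r)] := SP k.
  rewrite kr r0 => /(_ isT) [_ H _]; have := ler_norm ((S k).2 r - Y r).
  have : kappa * (X r - (S k).1 r) <= kappa * e.
    by rewrite ler_pM2l //; have := ler_norm (X r - (S k).1 r); rewrite distrC; lra.
  by lra.
have Yd r : r <= 0 -> Y r <= delta * expR (gamma * r).
  move=> r0; apply: (le_eps _ _ 1 ltr01) => e e0.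
  have [k [kr kX kY]] := approx _ _ e0 r0; have [_ _ _ _ /(_ r)] := SP k.
  by rewrite kr r0 => /(_ isT) [_ _ ?]; have := ler_norm (Y r - (S k).2 r); rewrite distrC; lra.
have hX0 : s <= X 0 <= m by rewrite X0.
have hY0 : 0 < Y 0 by rewrite Y0.
have hY1 : Y 0 <= 1 by rewrite Y0.
have hXY : kappa * (X 0 - s) <= Y 0 by exact: YX.
have Y_gt0 := orbit_Y dY hY0.
have XT := orbit_XT dX hX0.
have Ydelta r : r <= 0 -> Y r <= delta.
  move=> r0; apply: le_trans (Yd r r0) _; rewrite ger_pMr // expR_le1.
  by rewrite mulr_ge0_le0 // ltW.
exists X, Y; split.
- move=> t; apply: is_derive_eq (dX t) _; have [t0|/ltW t0] := leP 0 t.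
    exact: (orbit_dX dX dY hX0 hY0 hY1 hXY).
  rewrite /V cx_id ?cy_id ?sX ?(ltW (XT t)) // (ltW (Y_gt0 t)) /=.
  by apply: le_trans (Ydelta t t0) _; apply: le_trans delta_le1 _.
- move=> t; apply: is_derive_eq (dY t) _; have [t0|/ltW t0] := leP 0 t.
    exact: (orbit_dY dX dY hX0 hY0 hY1 hXY).
  rewrite /G cx_id ?cy_id ?sX ?(ltW (XT t)) // (ltW (Y_gt0 t)) /=.
  by apply: le_trans (Ydelta t t0) _; apply: le_trans delta_le1 _.
- exact: Y_gt0.
(* In backward time [Y] is at most [delta * expR (gamma * t)], and the cone forces [X] to [s] along
   with it. *)
- have small e : 0 < e -> \forall t \near -oo, t <= 0 /\ Y t <= e.
    move=> e0; have [r r0 rb] := linear_unbounded delta (mulr_gt0 e0 gamma0).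
    near=> t.
    have tr : t <= - r by near: t; apply: nbhs_ninfty_le; exact: num_real.
    have t0 : t <= 0 by lra.
    split=> //; apply: le_trans (Yd t t0) _.
    rewrite -[gamma * t]opprK expRN ler_pdivrMr ?expR_gt0 //; apply: le_trans (ltW rb) _.
    rewrite -mulrA ler_pM2l //.
    have : gamma * r <= gamma * (- t) by rewrite ler_pM2l //; lra.
    by have := expR_ge1Dx (- (gamma * t)); lra.
  split; apply/cvgrPdist_le => /= e e0.
    have := small (kappa * e) (mulr_gt0 kappa0 e0).
    apply: filterS => t [t0 Yt]; rewrite distrC ger0_norm ?subr_ge0 ?sX //.
    by rewrite -(ler_pM2l kappa0); apply: le_trans Yt; exact: YX.
  have := small e e0; apply: filterS => t [t0 Yt].
  by rewrite sub0r normrN gtr0_norm.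
- by split; [exact: (orbit_X_cvg dX dY) | exact: (orbit_Y_cvg dX dY)].
Unshelve. all: by end_near. Qed.

End PlanarConnection.

(** * Polynomial fields and small drifts *)

Section BoxLipschitz.
Context {R : realType}.

Definition square (B x y : R) := `|x| <= B /\ `|y| <= B.

(** The bound [K] is carried along because the Lipschitz constant of a product involves it; in this
    form the class contains all polynomials. *)
Definition square_lipschitz (h : R -> R -> R) := forall B, 0 < B -> exists L K,
  [/\ 0 <= L, 0 <= K, forall x y, square B x y -> `|h x y| <= K &
    lipschitz2 (square B) L h].

Lemma square_lipschitz_x : square_lipschitz (fun x _ => x).
Proof.
move=> B B0; exists 1, B; split=> //; [exact: ltW | by move=> x y [] |].
by move=> x y x' y' _ _; rewrite mul1r lerDl.
Qed.

Lemma square_lipschitz_y : square_lipschitz (fun _ y => y).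
Proof.
move=> B B0; exists 1, B; split=> //; [exact: ltW | by move=> x y [] |].
by move=> x y x' y' _ _; rewrite mul1r lerDr.
Qed.

Lemma square_lipschitz_cst (a : R) : square_lipschitz (fun _ _ => a).
Proof.
move=> B B0; exists 0, `|a|; split=> // x y x' y' _ _.
by rewrite subrr normr0 mul0r.
Qed.

Lemma square_lipschitzD (h k : R -> R -> R) : square_lipschitz h ->
  square_lipschitz k -> square_lipschitz (fun x y => h x y + k x y).
Proof.
move=> hl kl B B0; have [L [K [L0 K0 hK hL]]] := hl B B0.
have [L' [K' [L0' K0' kK kL]]] := kl B B0.
exists (L + L'), (K + K'); split; rewrite ?addr_ge0 //.
  by move=> x y xy; apply: le_trans (ler_normD _ _) (lerD (hK _ _ xy) (kK _ _ xy)).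
move=> x y x' y' xy xy'; rewrite opprD addrACA mulrDl.
exact: le_trans (ler_normD _ _) (lerD (hL _ _ _ _ xy xy') (kL _ _ _ _ xy xy')).
Qed.

Lemma square_lipschitzM (h k : R -> R -> R) : square_lipschitz h ->
  square_lipschitz k -> square_lipschitz (fun x y => h x y * k x y).
Proof.
move=> hl kl B B0; have [L [K [L0 K0 hK hL]]] := hl B B0.
have [L' [K' [L0' K0' kK kL]]] := kl B B0.
exists (K' * L + K * L'), (K * K'); split; rewrite ?addr_ge0 ?mulr_ge0 //.
  by move=> x y xy; rewrite normrM ler_pM ?hK ?kK.
move=> x y x' y' xy xy'.
have -> : h x y * k x y - h x' y' * k x' y' =
  k x y * (h x y - h x' y') + h x' y' * (k x y - k x' y') by ring.
apply: le_trans (ler_normD _ _) _; rewrite !normrM mulrDl -!mulrA.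
by apply: lerD; apply: ler_pM => //; [exact: kK | exact: hL | exact: hK | exact: kL].
Qed.

Lemma square_lipschitz_opp (h : R -> R -> R) : square_lipschitz h ->
  square_lipschitz (fun x y => h (- x) y).
Proof.
move=> hl B B0; have [L [K [L0 K0 hK hL]]] := hl B B0.
exists L, K; split=> // [x y [xB yB]|x y x' y' [xB yB] [xB' yB']].
  by apply: hK; split; rewrite ?normrN.
apply: le_trans (hL _ _ _ _ _ _) _; [by split; rewrite ?normrN..|].
have -> : - x - - x' = - (x - x') by ring.
by rewrite normrN.
Qed.

Lemma square_lipschitz_ext (h k : R -> R -> R) : (forall x y, h x y = k x y) ->
  square_lipschitz h -> square_lipschitz k.
Proof. by move=> hk; have -> : h = k by apply/funext => x; apply/funext. Qed.

Lemma square_lipschitz_horner (q : {poly R}) : square_lipschitz (fun _ y => q.[y]).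
Proof.
elim/poly_ind: q => [|q a IH].
  by apply: square_lipschitz_ext (square_lipschitz_cst 0) => x y; rewrite horner0.
apply: square_lipschitz_ext (square_lipschitzD (square_lipschitzM IH square_lipschitz_y)
  (square_lipschitz_cst a)) => x y.
by rewrite hornerMXaddC.
Qed.

Lemma square_lipschitz_hornerx (q : {poly R}) : square_lipschitz (fun x _ => q.[x]).
Proof.
elim/poly_ind: q => [|q a IH].
  by apply: square_lipschitz_ext (square_lipschitz_cst 0) => x y; rewrite horner0.
apply: square_lipschitz_ext (square_lipschitzD (square_lipschitzM IH square_lipschitz_x)
  (square_lipschitz_cst a)) => x y.
by rewrite hornerMXaddC.
Qed.

Lemma square_lipschitz_horner2 (q : {poly {poly R}}) :
  square_lipschitz (fun x y => q.[x, y]).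
Proof.
elim/poly_ind: q => [|q a IH].
  by apply: square_lipschitz_ext (square_lipschitz_cst 0) => x y; rewrite !horner0.
apply: square_lipschitz_ext (square_lipschitzD (square_lipschitzM IH square_lipschitz_x)
  (square_lipschitz_horner a)) => x y.
by rewrite hornerMXaddC hornerD hornerM hornerC.
Qed.

Lemma square_to_box (h : R -> R -> R) (s T B : R) : square_lipschitz h -> 0 < B ->
  exists2 L, 0 < L & lipschitz2 (planar_box s T B) L h.
Proof.
move=> hl B0; pose B' := B + `|s| + `|T|.
have B'0 : 0 < B' by rewrite /B'; have := normr_ge0 s; have := normr_ge0 T; lra.
have [L [_ [L0 _ _ hL]]] := hl B' B'0.
have sq x y : planar_box s T B x y -> square B' x y.
  move=> [/andP[sx xT] /andP[y0 yB]]; rewrite /square /B'.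
  have := ler_norm T; have := ler_norm (- s); rewrite normrN => ? ?.
  by have := normr_ge0 s; have := normr_ge0 T; split; rewrite ler_norml; apply/andP; split; lra.
exists (L + 1); first by lra.
move=> x y x' y' xy xy'; apply: le_trans (hL _ _ _ _ (sq _ _ xy) (sq _ _ xy')) _.
by rewrite ler_wpM2r ?addr_ge0 //; lra.
Qed.

End BoxLipschitz.

(** * Roots and signs of the drift *)

Section Drift.
Context {R : realType}.
Variable n : nat.
Implicit Types (x : R) (i k : nat).

Definition drift_poly : {poly R} := \prod_(1 <= k < 2 * n) ('X - k%:R%:P).

Lemma drift_polyE x : drift_poly.[x] = \prod_(1 <= k < 2 * n) (x - k%:R).
Proof. by rewrite horner_prod; apply: eq_bigr => k _; rewrite hornerXsubC. Qed.

Lemma drift_root k : (0 < k < 2 * n)%N -> drift_poly.[k%:R : R] = 0.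
Proof.
move=> kn; apply/eqP; rewrite drift_polyE prodf_seq_eq0; apply/hasP.
by exists k; rewrite ?mem_index_iota // subrr eqxx.
Qed.

Lemma prod_below (a b : nat) x : (forall k, (a <= k < b)%N -> k%:R < x) ->
  0 < \prod_(a <= k < b) (x - k%:R).
Proof. by move=> H; rewrite big_seq prodr_gt0 // => k; rewrite mem_index_iota subr_gt0 => /H. Qed.

Lemma prod_above (a b : nat) x : (forall k, (a <= k < b)%N -> x < k%:R) ->
  0 < (-1) ^+ (b - a) * \prod_(a <= k < b) (x - k%:R).
Proof.
move=> H; rewrite -prodr_const_nat -big_split /= big_seq prodr_gt0 // => k.
by rewrite mem_index_iota mulN1r opprB subr_gt0 => /H.
Qed.

Lemma drift_split (a : nat) x : (0 < a <= 2 * n)%N ->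
  (forall k, (1 <= k < a)%N -> k%:R < x) -> (forall k, (a <= k < 2 * n)%N -> x < k%:R) ->
  0 < (-1) ^+ (2 * n - a) * drift_poly.[x].
Proof.
move=> /andP[a0 an] lo hi; rewrite drift_polyE (@big_cat_nat _ _ _ a) //=.
by rewrite mulrCA mulr_gt0 ?prod_below ?prod_above.
Qed.

(** An odd number of factors is negative here, an even number just to the right of the node: under
    the minus sign in the vector field, nodes attract along the axis. *)
Lemma drift_lt0 i x : (i < n)%N -> (2 * i)%:R < x < (2 * i + 1)%:R -> drift_poly.[x] < 0.
Proof.
move=> i_n /andP[lo hi].
have := @drift_split (2 * i + 1)%N x; rewrite -signr_odd.
have -> : odd (2 * n - (2 * i + 1)) by rewrite oddB ?oddD ?oddM //=; lia.
rewrite expr1 mulN1r oppr_gt0; apply=> [|k kb|k kb]; first lia.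
  by apply: le_lt_trans lo; rewrite ler_nat; lia.
by apply: lt_le_trans hi _; rewrite ler_nat; lia.
Qed.

Lemma drift_gt0 i x : (i < n)%N -> (2 * i + 1)%:R < x < (2 * i + 2)%:R -> 0 < drift_poly.[x].
Proof.
move=> i_n /andP[lo hi].
have := @drift_split (2 * i + 2)%N x; rewrite -signr_odd.
have -> : odd (2 * n - (2 * i + 2)) = false by rewrite oddB ?oddD ?oddM //=; lia.
rewrite expr0 mul1r; apply=> [|k kb|k kb]; first lia.
  by apply: le_lt_trans lo; rewrite ler_nat; lia.
by apply: lt_le_trans hi _; rewrite ler_nat; lia.
Qed.

Lemma drift_bound (k : nat) (s T : R) : (0 < k < 2 * n)%N ->
  exists2 L, 0 < L & forall x, s <= x <= T -> s <= k%:R <= T ->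
    `|drift_poly.[x]| <= L * `|x - k%:R|.
Proof.
move=> kn; have [L L0 HL] := square_to_box s T (square_lipschitz_hornerx drift_poly) ltr01.
exists L => // x xsT ksT.
have := HL x 0 k%:R 0; rewrite drift_root // !subr0 normr0 addr0; apply.
  by split; rewrite ?lexx ?ler01.
by split; rewrite ?lexx ?ler01.
Qed.

End Drift.

(** * Planar connections for all small values of [eps] *)

Section SmallDrift.
Context {R : realType}.

Definition planar_orbit (p : R -> R) (f g : R -> R -> R) (s T : R) (X Y : R -> R) :=
  [/\ forall t : R, is_derive t 1 X (p (X t) + Y t * f (X t) (Y t)),
  forall t : R, is_derive t 1 Y (Y t * g (X t) (Y t)),
  forall t, 0 < Y t,
  X t @[t --> -oo] --> s /\ Y t @[t --> -oo] --> (0 : R) &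
  X t @[t --> +oo] --> T /\ Y t @[t --> +oo] --> (0 : R)].

Lemma small_drift_connection (p : R -> R) (f g : R -> R -> R)
    (s m m2 T kappa gamma f0 L C : R) :
  s < m -> m < m2 -> m2 < T -> 0 < kappa -> 0 < gamma -> 0 < f0 -> 0 < L -> 0 <= C ->
  continuous p -> square_lipschitz (fun x _ => p x) ->
  square_lipschitz f -> square_lipschitz g ->
  p T = 0 -> p m = 0 ->
  (forall x, s <= x <= m -> `|p x| <= L * (x - s)) ->
  (forall x, m < x < T -> 0 < p x) ->
  (forall x y, s <= x <= m -> 0 <= y -> kappa * (x - s) <= y -> f0 <= f x y) ->
  (forall x y, s <= x <= m -> 0 <= y -> kappa * (x - s) <= y -> gamma <= g x y) ->
  (forall x, s <= x <= m -> 2 * (kappa * f x (kappa * (x - s))) <= gamma) ->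
  (forall y, 0 < y -> 0 < f m y) ->
  (forall x y, m <= x <= T -> 0 <= y -> 0 <= f x y) ->
  (forall y, f T y = 0) ->
  (forall x y, s <= x <= m -> 1 <= y -> kappa * (x - s) <= y ->
    g x y <= C * (1 + y) * f x y) ->
  (forall x y, m <= x <= m2 -> 1 <= y -> g x y <= C * (1 + y) * f x y) ->
  (forall x y, m2 <= x <= T -> 0 <= y -> g x y <= - gamma) ->
  \forall eps \near (0 : R)^'+, exists X Y, planar_orbit (fun x => eps * p x) f g s T X Y.
Proof.
move=> sm mm2 m2T k0 g0 f00 L0 C0 cp lp lf lg pT pm plo ppos conef coneg edge fm fge fT gr1 gr2 sink.
(* These are the bounds that [2 * c < gamma] and [2 * c <= kappa * f0] impose for [c = eps * L]. *)
pose e0 := Num.min (gamma / (2 * L)) (kappa * f0 / (2 * L)).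
have L2 : 0 < 2 * L by rewrite mulr_gt0.
have e00 : 0 < e0 by rewrite lt_min !divr_gt0 // mulr_gt0.
near=> eps.
have eps0 : 0 < eps by near: eps; exact: nbhs_right_gt.
have epse : eps < e0 by near: eps; exact: nbhs_right_lt.
have c1 : 2 * (eps * L) < gamma.
  have : eps < gamma / (2 * L) by rewrite (lt_le_trans epse) // ge_min lexx.
  by rewrite ltr_pdivlMr //; lra.
have c2 : 2 * (eps * L) <= kappa * f0.
  have : eps <= kappa * f0 / (2 * L) by rewrite (le_trans (ltW epse)) // ge_min lexx orbT.
  by rewrite ler_pdivlMr //; lra.
have lep : square_lipschitz (fun x _ : R => eps * p x).
  exact: square_lipschitzM (square_lipschitz_cst eps) lp.
have := @planar_connection R (fun x => eps * p x) f g s m m2 T kappa gamma f0 (eps * L) C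
  sm mm2 m2T k0 g0 f00 C0 c1 c2.
move=> /(_ _ _ _ _ _ conef coneg edge fm fge fT gr1 gr2 sink); apply.
- by move=> x; apply: cvgM; [exact: cvg_cst | exact: cp].
- by rewrite pT mulr0.
- by move=> x xs; rewrite normrM gtr0_norm // -mulrA ler_pM2l // plo.
- by rewrite pm mulr0.
- by move=> x xm; rewrite mulr_gt0 // ppos.
move=> B B0.
have [L1 L10 H1] := square_to_box s T (square_lipschitzD lep (square_lipschitzM square_lipschitz_y lf)) B0.
have [L3 L30 H3] := square_to_box s T (square_lipschitzM square_lipschitz_y lg) B0.
exists (L1 + L3); split; first exact: addr_gt0.
  move=> x y x' y' a b; apply: le_trans (H1 _ _ _ _ a b) _.
  by rewrite ler_wpM2r ?addr_ge0 // lerDl ltW.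
move=> x y x' y' a b; apply: le_trans (H3 _ _ _ _ a b) _.
by rewrite ler_wpM2r ?addr_ge0 // lerDr ltW.
Unshelve. all: by end_near. Qed.

Lemma pos_lower_bound (h : R -> R) (a b : R) : a <= b -> continuous h ->
  (forall x, a <= x <= b -> 0 < h x) -> exists2 d, 0 < d & forall x, a <= x <= b -> d <= h x.
Proof.
move=> ab ch h0; have [|z zab hz] := EVT_min ab (f := h); first exact: continuous_subspaceT.
exists (h z); first by apply: h0; move: zab; rewrite in_itv.
by move=> x xab; apply: hz; rewrite in_itv.
Qed.

Lemma upper_bound (h : R -> R) (a b : R) : a <= b -> continuous h ->
  exists2 d, 0 < d & forall x, a <= x <= b -> h x <= d.
Proof.
move=> ab ch; have [|z zab hz] := EVT_max ab (f := h); first exact: continuous_subspaceT.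
exists (`|h z| + 1); first by rewrite ltr_wpDl.
move=> x xab; have : h x <= h z by apply: hz; rewrite in_itv.
by have := ler_norm (h z); lra.
Qed.

Lemma plain_connection (p : R -> R) (F G : {poly R}) (s m m2 T L : R) :
  s < m -> m < m2 -> m2 < T -> 0 < L -> continuous p -> square_lipschitz (fun x _ => p x) ->
  p T = 0 -> p m = 0 -> (forall x, s <= x <= m -> `|p x| <= L * (x - s)) ->
  (forall x, m < x < T -> 0 < p x) ->
  (forall x, s <= x < T -> 0 < F.[x]) -> F.[T] = 0 ->
  (forall x, s <= x <= m -> 0 < G.[x]) -> (forall x, m2 <= x <= T -> G.[x] < 0) ->
  \forall eps \near (0 : R)^'+, exists X Y,
    planar_orbit (fun x => eps * p x) (fun x _ => F.[x]) (fun x _ => G.[x]) s T X Y.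
Proof.
move=> sm mm2 m2T L0 cp lp pT pm plo ppos F0 FT G0 Gneg.
have sm2 := lt_trans sm mm2.
have cF := @continuous_horner R F; have cG := @continuous_horner R G.
have cN : continuous (fun x => - G.[x]) by move=> x; apply: cvgN; exact: cG.
have [f0 f00 Ff0] : exists2 d, 0 < d & forall x, s <= x <= m2 -> d <= F.[x].
  apply: (pos_lower_bound (ltW sm2) cF) => x /andP[sx xm].
  by apply: F0; rewrite sx (le_lt_trans xm).
have [F1 F10 FF1] := upper_bound (ltW sm) cF.
have [g1 g10 Gg1] := pos_lower_bound (ltW sm) cG G0.
have [x|g2 g20 Gg2] := pos_lower_bound (ltW m2T) cN; first by rewrite oppr_gt0; exact: Gneg.
have [g3 g30 Gg3] := upper_bound (ltW sm2) cG.
(* The edge condition with the bound [F1] on [f] dictates [kappa]; [C] is the ratio of an upper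
   bound of [g] to a lower bound of [f] up to [m2]. *)
pose gamma := Num.min g1 g2; pose kappa := gamma / (2 * F1); pose C := g3 / f0.
have gamma0 : 0 < gamma by rewrite lt_min g10.
have kappa0 : 0 < kappa by rewrite divr_gt0 // mulr_gt0.
have C0 : 0 <= C by rewrite divr_ge0 // ltW.
have grow x y : s <= x <= m2 -> 1 <= y -> G.[x] <= C * (1 + y) * F.[x].
  move=> xm y1; apply: le_trans (Gg3 _ xm) _.
  have -> : g3 = C * (1 * f0) by rewrite mul1r divfK // gt_eqF.
  by rewrite -mulrA ler_wpM2l // ler_pM ?(ltW f00) ?Ff0 //; lra.
have FT0 x : m <= x <= T -> 0 <= F.[x].
  move=> /andP[mx]; rewrite le_eqVlt => /predU1P[->|xT]; first by rewrite FT.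
  by rewrite ltW // F0 // xT (le_trans (ltW sm)).
apply: (@small_drift_connection p _ _ s m m2 T kappa gamma f0 L C) => //.
- exact: square_lipschitz_hornerx.
- exact: square_lipschitz_hornerx.
- by move=> x y /andP[sx xm] _ _; rewrite Ff0 // sx (le_trans xm) // ltW.
- by move=> x y xs _ _; apply: le_trans (Gg1 _ xs); rewrite ge_min lexx.
- move=> x xs; rewrite mulrA.
  have <- : 2 * kappa * F1 = gamma by rewrite /kappa; field; rewrite gt_eqF.
  by rewrite ler_wpM2l ?FF1 // mulr_ge0 // ltW.
- by move=> y _; rewrite F0 // (ltW sm) (lt_trans mm2).
- by move=> x y xT _; exact: FT0.
- by move=> x y /andP[sx xm] y1 _; apply: grow => //; rewrite sx (le_trans xm) // ltW.
- by move=> x y /andP[mx xm] y1; apply: grow => //; rewrite xm (le_trans (ltW sm)).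
move=> x y xT _; rewrite lerNr; apply: le_trans (Gg2 _ xT).
by rewrite ge_min lexx orbT.
Unshelve. all: by end_near. Qed.

End SmallDrift.

(** * Labels 0, 1, 2 *)

Section Movers.
Context {R : realType}.
Variables (n c : nat).
Implicit Types (x : R) (i t u : nat).

Definition pos i : R := (2 * i + 1)%:R.

Lemma posE i : pos i = 2 * i%:R + 1.
Proof. by rewrite /pos natrD natrM. Qed.

Lemma pos_le i t : (pos i <= pos t) = (i <= t)%N.
Proof. by rewrite /pos ler_nat; apply/idP/idP; lia. Qed.

Lemma pos_lt i t : (pos i < pos t) = (i < t)%N.
Proof. by rewrite /pos ltr_nat; apply/idP/idP; lia. Qed.

(* The first factor is a wall between the nodes of indices [c] and [c + 1]; it
   keeps node 0 from node 3 and node 1 from node 4, and is harmless for [c = 2]. *)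
Definition mover_f : {poly R} := ('X - (2 * c + 2)%:R%:P) ^+ 2 *
  \prod_(2 <= u < n | (u %% 3 == c)%N) ('X - (pos u)%:P) ^+ 2.

(** A factor is negative only within distance 1/2 of its node. Nodes of one label are at least 6
    apart, so at most one factor is negative at a time. *)
Definition mover_g : {poly R} :=
  \prod_(2 <= u < n | (u %% 3 == c)%N) (('X - (pos u)%:P) ^+ 2 - (1 / 4)%:P).

Lemma mover_fE x : mover_f.[x] = (x - (2 * c + 2)%:R) ^+ 2 *
  \prod_(2 <= u < n | (u %% 3 == c)%N) (x - pos u) ^+ 2.
Proof.
rewrite /mover_f hornerM horner_exp hornerXsubC horner_prod; congr (_ * _).
by apply: eq_bigr => u _; rewrite horner_exp hornerXsubC.
Qed.

Lemma mover_gE x : mover_g.[x] =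
  \prod_(2 <= u < n | (u %% 3 == c)%N) ((x - pos u) ^+ 2 - 1 / 4).
Proof.
by rewrite /mover_g horner_prod; apply: eq_bigr => u _; rewrite hornerD hornerN hornerC horner_exp hornerXsubC.
Qed.

Lemma mover_f_ge0 x : 0 <= mover_f.[x].
Proof.
by rewrite mover_fE mulr_ge0 ?sqr_ge0 // prodr_ge0 // => u _; exact: sqr_ge0.
Qed.

Lemma mover_f_gt0 x : x != (2 * c + 2)%:R ->
  (forall u, (2 <= u < n)%N -> (u %% 3 = c)%N -> x != pos u) -> 0 < mover_f.[x].
Proof.
move=> xc xu; rewrite mover_fE mulr_gt0 //.
  by rewrite exprn_even_gt0 //= subr_eq0.
rewrite big_seq_cond prodr_gt0 // => u; rewrite mem_index_iota => /andP[un /eqP uc].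
by rewrite exprn_even_gt0 //= subr_eq0 xu.
Qed.

Lemma mover_f_root_wall : mover_f.[(2 * c + 2)%:R] = 0.
Proof. by rewrite mover_fE subrr expr0n mul0r. Qed.

Lemma mover_f_root u : (2 <= u < n)%N -> (u %% 3 = c)%N -> mover_f.[pos u] = 0.
Proof.
move=> un uc; apply/eqP; rewrite mover_fE mulf_eq0; apply/orP; right.
rewrite prodf_seq_eq0; apply/hasP; exists u; first by rewrite mem_index_iota.
by rewrite uc eqxx subrr expr0n eqxx.
Qed.

Lemma mover_g_gt0 x : (forall u, (2 <= u < n)%N -> (u %% 3 = c)%N ->
  (pos u + 1 <= x) \/ (x <= pos u - 1)) -> 0 < mover_g.[x].
Proof.
move=> xu; rewrite mover_gE big_seq_cond prodr_gt0 // => u.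
rewrite mem_index_iota => /andP[un /eqP uc].
suff : 1 <= (x - pos u) ^+ 2 by lra.
by have [xu1|xu1] := xu _ un uc; nra.
Qed.

Lemma mover_g_lt0 x t : (2 <= t < n)%N -> (t %% 3 = c)%N ->
  pos t - 1 / 4 <= x <= pos t + 1 / 4 -> mover_g.[x] < 0.
Proof.
move=> tn tc /andP[xl xr]; rewrite mover_gE -big_filter (bigD1_seq t) /=; last 2 first.
- by rewrite mem_filter tc eqxx mem_index_iota.
- by rewrite filter_uniq // iota_uniq.
rewrite nmulr_rlt0; last by nra.
rewrite big_seq_cond prodr_gt0 // => u.
rewrite mem_filter mem_index_iota => /andP[/andP[/eqP uc un] ut].
suff : 1 <= (x - pos u) ^+ 2 by lra.
have [tu|tu] : (u + 3 <= t)%N \/ (t + 3 <= u)%N by move/eqP: ut; lia.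
  have : (u + 3)%:R <= t%:R :> R by rewrite ler_nat.
  by move: xl xr; rewrite natrD !posE; nra.
have : (t + 3)%:R <= u%:R :> R by rewrite ler_nat.
by move: xl xr; rewrite natrD !posE; nra.
Qed.

End Movers.

Section MoverConnection.
Context {R : realType}.
Variable n : nat.
Let P : {poly R} := drift_poly n.

Lemma drift_cvg : continuous (fun x : R => - P.[x]).
Proof. by move=> x; apply: cvgN; exact: continuous_horner. Qed.

Lemma drift_square_lipschitz : square_lipschitz (fun x _ : R => - P.[x]).
Proof.
apply: square_lipschitz_ext (square_lipschitz_hornerx (- P)) => x y.
by rewrite hornerN.
Qed.

Lemma drift_pos i : (i < n)%N -> P.[pos i] = 0.
Proof. by move=> i_n; apply: drift_root; lia. Qed.

Lemma mover_connection (i t : nat) : (2 <= t < n)%N -> (t - 2 <= i < t)%N ->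
  \forall eps \near (0 : R)^'+, exists X Y,
    planar_orbit (fun x => eps * - P.[x]) (fun x _ => (mover_f n (t %% 3)).[x])
      (fun x _ => (mover_g n (t %% 3)).[x]) (pos i) (pos t) X Y.
Proof.
move=> tn it.
have itR : (i + 1)%:R <= t%:R :> R by rewrite ler_nat; lia.
have tiR : t%:R <= (i + 2)%:R :> R by rewrite ler_nat; lia.
rewrite natrD in itR; rewrite natrD in tiR.
have mE : pos t - 1 = (2 * t)%:R :> R by rewrite posE natrM; ring.
have kn : (0 < 2 * i + 1 < 2 * n)%N by lia.
have [L L0 HL] := @drift_bound R n (2 * i + 1) (pos i) (pos t) kn.
have ti : pos i <= pos t :> R by rewrite pos_le; lia.
(* [m] is the even integer before the target, a root of the drift after which the drift points to
   the target. *)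
apply: (@plain_connection R (fun x => - P.[x]) _ _ (pos i) (pos t - 1)
  (pos t - 1 / 4) (pos t) L) => //.
- by rewrite !posE; lra.
- lra.
- lra.
- exact: drift_cvg.
- exact: drift_square_lipschitz.
- by rewrite drift_pos ?oppr0 //; case/andP: tn.
- by rewrite mE drift_root ?oppr0 //; lia.
- move=> x /andP[ix xt]; rewrite normrN -(ger0_norm (_ : 0 <= x - pos i)) ?subr_ge0 //.
  by apply: HL; rewrite ?ix ?lexx //; lra.
- move=> x xt; rewrite oppr_gt0; apply: (@drift_lt0 _ _ t); first by case/andP: tn.
  by rewrite -mE.
- move=> x /andP[ix xt]; apply: mover_f_gt0 => [|u un ut]; last first.
    have [ut3|tu] : (u + 3 <= t)%N \/ (t <= u)%N by lia.
      have : (u + 3)%:R <= t%:R :> R by rewrite ler_nat.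
      by move: ix; rewrite natrD !posE; lra.
    have : t%:R <= u%:R :> R by rewrite ler_nat.
    by move: xt; rewrite !posE; lra.
  (* The extra wall lies beyond the target if [t = 2], and before both admissible sources
     otherwise. *)
  have [t2|t3] : (t = 2)%N \/ (t %% 3 + 3 <= t)%N by lia.
    by move: xt; rewrite t2 /pos; apply: contraTneq => ->; rewrite -leNgt ler_nat.
  apply: contraTneq ix => ->; rewrite -ltNge /pos ltr_nat; lia.
- by rewrite mover_f_root //; case/andP: tn => -> ->.
- move=> x /andP[ix xt]; apply: mover_g_gt0 => u un ut.
  have [ut3|tu] : (u + 3 <= t)%N \/ (t <= u)%N by lia.
    left; have : (u + 3)%:R <= t%:R :> R by rewrite ler_nat.
    by move: ix; rewrite natrD !posE; lra.
  right; have : t%:R <= u%:R :> R by rewrite ler_nat.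
  by move: xt; rewrite !posE; lra.
move=> x /andP[xl xr]; apply: (@mover_g_lt0 _ _ _ _ t) => //.
by rewrite xl /=; lra.
Qed.

End MoverConnection.

(** * Labels 3, 4 *)

Section WrapEstimates.
Context {R : realType}.
Variable N : R.
Hypothesis N3 : 3 <= N.
Implicit Types u y d : R.

(* In [u = x - tau], the middle nodes lie in ]1, 2 N - 5[, where [wrap_q < 0], and
   the nodes to be connected to [u = 0] from the right lie at [2 N - 4] or more. *)
Definition wrap_q u : R := (u - 1) * (u - (2 * N - 5)).
(** The field uses [- wrap_f]. Over the middle, where [wrap_q] is negative, the sign depends on the
    height: high orbits move towards [u = 0], sufficiently low ones away from it. *)
Definition wrap_f u y : R := u * (wrap_q u + y / 4).
(** The factor [u ^+ 2 - 1 / 4] makes [u = 0] the only attracting node. The last factor is positive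
    at [y = 0], but over the middle it is negative at [y = 2], the lid of the trapping box. *)
Definition wrap_g u y : R :=
  (5 * N) ^+ 6 * (u ^+ 2 - 1 / 4) * (N ^+ 2 * (y - 2) ^+ 2 + wrap_q u).

Let M : R := (5 * N) ^+ 6.

Let M0 : 0 < M. Proof. by rewrite exprn_gt0 //; have := N3; lra. Qed.

Lemma wrap_q_ge u : - (N - 3) ^+ 2 <= wrap_q u.
Proof.
have -> : wrap_q u = (u - (N - 2)) ^+ 2 - (N - 3) ^+ 2 by rewrite /wrap_q; ring.
by rewrite lerDr sqr_ge0.
Qed.

Lemma wrap_q_le u : -2 <= u <= 2 * N - 2 -> wrap_q u <= 2 * N ^+ 2.
Proof.
move=> /andP[u1 u2].
have : (u + 2) * (u - (2 * N - 2)) <= 0 by rewrite mulr_ge0_le0; lra.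
by rewrite /wrap_q; have := N3; nra.
Qed.

Lemma wrap_q_near u : u <= 1 -> 0 <= wrap_q u.
Proof. by move=> u1; rewrite /wrap_q; have := N3; nra. Qed.

(** Where [u ^+ 2 < 1 / 4], the last factor is nonnegative and so [wrap_g] is at most 0; elsewhere
    the factors are bounded one by one. *)
Lemma wrap_g_le u y : -2 <= u <= 2 * N - 2 -> 1 <= y -> 1 / 4 <= u ^+ 2 \/ u <= 1 ->
  wrap_g u y <= 12 * M * N ^+ 4 * y ^+ 2.
Proof.
move=> u2 y1 uu.
have N0 : 0 < N ^+ 2 by rewrite exprn_gt0 //; have := N3; lra.
have R0 : 0 <= 12 * M * N ^+ 4 * y ^+ 2.
  have N4 : 0 <= N ^+ 4 by rewrite exprn_ge0 //; have := N3; lra.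
  by apply: mulr_ge0 (sqr_ge0 _); apply: mulr_ge0 N4; apply: mulr_ge0 (ltW M0).
have [ul|ul] := leP (1 / 4) (u ^+ 2); last first.
  have q0 : 0 <= wrap_q u by apply: wrap_q_near; case: uu; lra.
  apply: le_trans R0; rewrite /wrap_g -/M mulr_le0_ge0 //.
    by rewrite mulr_ge0_le0 ?ltW //; lra.
  by rewrite addr_ge0 // mulr_ge0 ?sqr_ge0 ?ltW.
have k1 : N ^+ 2 * (y - 2) ^+ 2 + wrap_q u <= 3 * N ^+ 2 * y ^+ 2.
  have q2 := wrap_q_le u2.
  have : N ^+ 2 * ((y - 2) ^+ 2 + 2) <= N ^+ 2 * (3 * y ^+ 2).
    by rewrite ler_pM2l //; nra.
  lra.
have u4 : u ^+ 2 - 1 / 4 <= 4 * N ^+ 2.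
  have [a b] := andP u2.
  suff : u ^+ 2 <= (2 * N) ^+ 2 by rewrite exprMn; lra.
  by rewrite -subr_ge0 subr_sqr mulr_ge0 //; have := N3; lra.
have k2 : (u ^+ 2 - 1 / 4) * (N ^+ 2 * (y - 2) ^+ 2 + wrap_q u)
    <= (u ^+ 2 - 1 / 4) * (3 * N ^+ 2 * y ^+ 2).
  by rewrite ler_wpM2l // subr_ge0.
have k3 : (u ^+ 2 - 1 / 4) * (3 * N ^+ 2 * y ^+ 2) <= 4 * N ^+ 2 * (3 * N ^+ 2 * y ^+ 2).
  rewrite ler_wpM2r //; apply: mulr_ge0 (sqr_ge0 _).
  by apply: mulr_ge0 (sqr_ge0 _).
rewrite /wrap_g -/M -mulrA.
have -> : 12 * M * N ^+ 4 * y ^+ 2 = M * (4 * N ^+ 2 * (3 * N ^+ 2 * y ^+ 2)) by ring.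
by rewrite ler_pM2l //; exact: le_trans k2 k3.
Qed.

Lemma wrap_growth u y h : -2 <= u <= 2 * N - 2 -> 1 <= y -> 1 / 4 <= u ^+ 2 \/ u <= 1 ->
  y / 16 <= h -> wrap_g u y <= 192 * M * N ^+ 4 * (1 + y) * h.
Proof.
move=> u2 y1 uu hy; apply: le_trans (wrap_g_le u2 y1 uu) _.
have -> : 12 * M * N ^+ 4 * y ^+ 2 = 192 * M * N ^+ 4 * (y * (y / 16)) by field.
have N4 : 0 <= N ^+ 4 by rewrite exprn_ge0 //; have := N3; lra.
rewrite -[leRHS]mulrA; apply: ler_wpM2l.
  by apply: mulr_ge0 N4; apply: mulr_ge0 (ler0n _ _) (ltW M0).
by rewrite ler_pM //; lra.
Qed.

Lemma wrap_sink u y : - 1 / 4 <= u <= 1 / 4 -> wrap_g u y <= - (M / 16).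
Proof.
move=> /andP[u1 u2].
have uu : u ^+ 2 <= 1 / 16 by nra.
have q1 : 9 / 16 <= wrap_q u by rewrite /wrap_q; have := N3; nra.
have k1 : 9 / 16 <= N ^+ 2 * (y - 2) ^+ 2 + wrap_q u.
  have : 0 <= N ^+ 2 * (y - 2) ^+ 2 by rewrite mulr_ge0 ?sqr_ge0.
  by lra.
have -> : - (M / 16) = M * - (1 / 16) by field.
rewrite /wrap_g -/M -mulrA ler_pM2l //.
by move: (N ^+ 2 * _ + _) k1 => k k1; nra.
Qed.

(** [d] is the abscissa of the source. Within 1/2 of it [wrap_q] is positive by itself; farther left
    the cone has height at least [8 * N ^+ 2], which outweighs the minimum of [wrap_q]. Hence the
    slope [16 * N ^+ 2]. *)
Lemma wrap_cone d u y : 2 * N - 4 <= d -> 1 <= u <= d -> 0 <= y ->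
  16 * N ^+ 2 * (d - u) <= y ->
  [/\ y / 8 <= wrap_q u + y / 4, 1 / 4 <= wrap_q u + y / 4 &
    1 / 4 <= N ^+ 2 * (y - 2) ^+ 2 + wrap_q u].
Proof.
move=> d4 /andP[u1 ud] y0 yd.
have nn : 9 <= N ^+ 2 by have := N3; nra.
have [du|du] := leP (d - u) (1 / 2).
  have q1 : 1 / 4 <= wrap_q u by rewrite /wrap_q; have := N3; nra.
  have : 0 <= N ^+ 2 * (y - 2) ^+ 2 by rewrite mulr_ge0 ?sqr_ge0.
  by split; lra.
have y8 : 8 * N ^+ 2 <= y by apply: le_trans yd; nra.
have q1 := wrap_q_ge u.
have q2 : (N - 3) ^+ 2 <= N ^+ 2 by have := N3; nra.
have k : N ^+ 2 * 1 <= N ^+ 2 * (y - 2) ^+ 2 by rewrite ler_wpM2l ?sqr_ge0 //; nra.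
split; try lra.
have : N ^+ 2 * 2 <= N ^+ 2 * (y - 2) ^+ 2 by rewrite ler_wpM2l ?sqr_ge0 //; nra.
by lra.
Qed.

Lemma wrap_g_ge u y : 1 <= u ^+ 2 -> 1 / 4 <= N ^+ 2 * (y - 2) ^+ 2 + wrap_q u ->
  M / 16 <= wrap_g u y.
Proof.
move=> u1 k; have -> : M / 16 = M * (1 / 16) by field.
rewrite /wrap_g -/M -mulrA ler_pM2l //.
by move: (N ^+ 2 * _ + _) k => k k1; nra.
Qed.

(** The left side is at most [128 * N ^+ 5 + 512 * N ^+ 6], and [5 ^+ 6 / 16] exceeds 976: this is
    what the factor [(5 * N) ^+ 6] is for. *)
Lemma wrap_edge d u : d <= 2 * N - 2 -> 1 <= u <= d ->
  2 * (16 * N ^+ 2 * wrap_f u (16 * N ^+ 2 * (d - u))) <= M / 16.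
Proof.
move=> d2 /andP[u1 ud].
have q2 : wrap_q u <= 2 * N ^+ 2 by apply: wrap_q_le; lra.
have N0 : 0 < N by have := N3; lra.
have h1 : wrap_q u + 16 * N ^+ 2 * (d - u) / 4 <= 2 * N ^+ 2 + 8 * N ^+ 3.
  have : N ^+ 2 * (d - u) <= N ^+ 2 * (2 * N) by rewrite ler_pM2l ?exprn_gt0 //; lra.
  have -> : N ^+ 2 * (2 * N) = 2 * N ^+ 3 by ring.
  lra.
have h2 : wrap_f u (16 * N ^+ 2 * (d - u)) <= 2 * N * (2 * N ^+ 2 + 8 * N ^+ 3).
  rewrite /wrap_f; apply: (@le_trans _ _ (u * (2 * N ^+ 2 + 8 * N ^+ 3))).
    by rewrite ler_pM2l //; lra.
  by rewrite ler_wpM2r ?addr_ge0 ?mulr_ge0 ?exprn_ge0 ?(ltW N0) //; lra.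
have h3 : 16 * N ^+ 2 * wrap_f u (16 * N ^+ 2 * (d - u)) <=
    16 * N ^+ 2 * (2 * N * (2 * N ^+ 2 + 8 * N ^+ 3)).
  by rewrite ler_pM2l // mulr_gt0 ?exprn_gt0.
have n6 : 3 * N ^+ 5 <= N ^+ 6 by rewrite [N ^+ 6]exprS ler_pM2r ?exprn_gt0.
have -> : M / 16 = 15625 / 16 * N ^+ 6 by rewrite /M; field.
have n60 : 0 < N ^+ 6 by rewrite exprn_gt0.
have E : 16 * N ^+ 2 * (2 * N * (2 * N ^+ 2 + 8 * N ^+ 3)) = 64 * N ^+ 5 + 256 * N ^+ 6 by ring.
by rewrite E in h3; lra.
Qed.

Lemma wrap_f_left u y : u <= -1 -> 0 <= y -> 4 + y / 4 <= - wrap_f u y.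
Proof.
move=> u1 y0.
have q4 : 4 <= wrap_q u by rewrite /wrap_q; have := N3; nra.
rewrite /wrap_f -mulNr; move: (wrap_q u) q4 => q q4.
have : 0 <= (- u - 1) * (q + y / 4) by rewrite mulr_ge0; lra.
by lra.
Qed.

Lemma wrap_g_left u y : u <= -1 -> M / 16 <= wrap_g u y.
Proof.
move=> u1; apply: wrap_g_ge; first by nra.
have q4 : 4 <= wrap_q u by rewrite /wrap_q; have := N3; nra.
have : 0 <= N ^+ 2 * (y - 2) ^+ 2 by rewrite mulr_ge0 ?sqr_ge0.
by lra.
Qed.

Lemma wrap_f_le0 u y : 0 <= u <= 1 -> 0 <= y -> 0 <= wrap_f u y.
Proof.
move=> /andP[u0 u1] y0; have q0 := wrap_q_near u1.
by rewrite /wrap_f mulr_ge0 //; lra.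
Qed.

Lemma wrap_f_ge0 u y : u <= 0 -> 0 <= y -> 0 <= - wrap_f u y.
Proof.
move=> u0 y0; have q0 := @wrap_q_near u (le_trans u0 ler01).
by rewrite /wrap_f -mulNr mulr_ge0 //; lra.
Qed.

Lemma wrap_f_growth u y : u <= 1 -> 0 <= y -> 1 / 4 <= `|u| ->
  y / 16 <= `|u| * (wrap_q u + y / 4).
Proof.
move=> u1 y0 ua; have q0 := wrap_q_near u1.
move: `|u| (wrap_q u) ua q0 => a q ua q0.
have : 0 <= (a - 1 / 4) * (q + y / 4) by rewrite mulr_ge0; lra.
by lra.
Qed.

Lemma wrap_edge_left u : -2 <= u <= -1 -> 2 * (1 * - wrap_f u (1 * (u + 2))) <= M / 16.
Proof.
move=> /andP[u2 u1].
have q2 : wrap_q u <= 2 * N ^+ 2 by apply: wrap_q_le; have := N3; lra.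
have n1 : 1 <= N ^+ 2 by have := N3; nra.
have n6 : N ^+ 2 <= N ^+ 6.
  have -> : N ^+ 6 = N ^+ 2 * (N ^+ 2 * N ^+ 2) by ring.
  by rewrite ler_peMr ?(le_trans ler01) //; nra.
have -> : M / 16 = 15625 / 16 * N ^+ 6 by rewrite /M; field.
have k : - u * (wrap_q u + (u + 2) / 4) <= - u * (2 * N ^+ 2 + 1 / 4).
  by rewrite ler_wpM2l //; lra.
have k' : - u * (2 * N ^+ 2 + 1 / 4) <= 2 * (2 * N ^+ 2 + 1 / 4).
  by rewrite ler_wpM2r //; lra.
by rewrite /wrap_f !mul1r -mulNr; lra.
Qed.

End WrapEstimates.

Section WrapConnection.
Context {R : realType}.
Variable n : nat.
Hypothesis n3 : (3 <= n)%N.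
Let N : R := n%:R.
Let P : {poly R} := drift_poly n.

Let N3 : 3 <= N. Proof. by rewrite ler_nat. Qed.

Definition wrap_qpoly (tau : R) : {poly {poly R}} :=
  ('X - tau%:P%:P - 1) * ('X - tau%:P%:P - (2 * n%:R - 5)%:P%:P).

Definition wrap_fpoly (tau : R) : {poly {poly R}} :=
  - (('X - tau%:P%:P) * (wrap_qpoly tau + 'X%:P * (1 / 4)%:P%:P)).

Definition wrap_gpoly (tau : R) : {poly {poly R}} :=
  ((5 * n%:R) ^+ 6)%:P%:P * (('X - tau%:P%:P) ^+ 2 - (1 / 4)%:P%:P) *
  ((n%:R ^+ 2)%:P%:P * ('X%:P - 2%:P%:P) ^+ 2 + wrap_qpoly tau).

Lemma wrap_qpolyE tau x y : (wrap_qpoly tau).[x, y] = wrap_q N (x - tau).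
Proof. by rewrite /wrap_qpoly /wrap_q -[1]/(1%:P%:P) !hornerE. Qed.

Lemma wrap_fpolyE tau x y : (wrap_fpoly tau).[x, y] = - wrap_f N (x - tau) y.
Proof.
by rewrite /wrap_fpoly /wrap_f !(hornerN, hornerM, hornerD, wrap_qpolyE, hornerX, hornerC) mul1r.
Qed.

Lemma wrap_gpolyE tau x y : (wrap_gpoly tau).[x, y] = wrap_g N (x - tau) y.
Proof.
by rewrite /wrap_gpoly /wrap_g !(horner_exp, hornerN, hornerM, hornerD, wrap_qpolyE, hornerX, hornerC).
Qed.

Let lipf tau : square_lipschitz (fun x y : R => - wrap_f N (x - tau) y).
Proof.
by apply: square_lipschitz_ext (square_lipschitz_horner2 (wrap_fpoly tau)) => x y; rewrite wrap_fpolyE.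
Qed.

Let lipg tau : square_lipschitz (fun x y : R => wrap_g N (x - tau) y).
Proof.
by apply: square_lipschitz_ext (square_lipschitz_horner2 (wrap_gpoly tau)) => x y; rewrite wrap_gpolyE.
Qed.

Let gamma0 : 0 < (5 * N) ^+ 6 / 16.
Proof. by rewrite divr_gt0 // exprn_gt0 //; have := N3; lra. Qed.

Let C0 : 0 <= 192 * (5 * N) ^+ 6 * N ^+ 4.
Proof.
have N0 : 0 <= N by have := N3; lra.
apply: mulr_ge0 (exprn_ge0 _ N0); apply: mulr_ge0; first exact: ler0n.
by rewrite exprn_ge0 // mulr_ge0.
Qed.

(** The edge from node 0 to node 1 is the only one that reaches one of the first two nodes from the
    left. There [wrap_q] is positive and a cone of slope 1 suffices. *)
Lemma wrap_connection_right :
  \forall eps \near (0 : R)^'+, exists X Y,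
    planar_orbit (fun x => eps * - P.[x]) (fun x y => - wrap_f N (x - pos 1) y)
      (fun x y => wrap_g N (x - pos 1) y) (pos 0) (pos 1) X Y.
Proof.
have kn : (0 < 1 < 2 * n)%N by move: n3; lia.
have [L L0 HL] := @drift_bound R n 1 1 3 kn.
have p0E : pos 0 = 1 :> R by rewrite posE; ring.
have p1E : pos 1 = 3 :> R by rewrite posE; ring.
rewrite p0E p1E.
have NN := N3.
have p3 : P.[3] = 0 by rewrite -[3]/(3%:R); apply: drift_root; move: n3; lia.
have p2 : P.[2] = 0 by rewrite -[2]/(2%:R); apply: drift_root; move: n3; lia.
apply: (@small_drift_connection R (fun x => - P.[x]) _ _ 1 2 (11 / 4) 3 1
  ((5 * N) ^+ 6 / 16) (1 / 4) L (192 * (5 * N) ^+ 6 * N ^+ 4)) => //.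
- by lra.
- by lra.
- by lra.
- exact: drift_cvg.
- exact: drift_square_lipschitz.
- by rewrite p3 oppr0.
- by rewrite p2 oppr0.
- move=> x /andP[x1 x2]; rewrite normrN -(ger0_norm (_ : 0 <= x - 1)) ?subr_ge0 //.
  by apply: HL; apply/andP; split; lra.
- move=> x x23; rewrite oppr_gt0; apply: (@drift_lt0 _ _ 1); first by move: n3; lia.
  by [].
- move=> x y x12 y0 _; have : 4 + y / 4 <= - wrap_f N (x - 3) y by apply: wrap_f_left; lra.
  by lra.
- by move=> x y x12 y0 _; apply: wrap_g_left; lra.
- move=> x x12; have -> : x - 1 = x - 3 + 2 by ring.
  by apply: wrap_edge_left; lra.
- move=> y y0; have : 4 + y / 4 <= - wrap_f N (2 - 3) y by apply: wrap_f_left; lra.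
  by lra.
- by move=> x y x23 y0; apply: wrap_f_ge0; lra.
- by move=> y; rewrite /wrap_f subrr mul0r oppr0.
- move=> x y x12 y1 _; apply: wrap_growth => //; [lra | by left; nra |].
  have : 4 + y / 4 <= - wrap_f N (x - 3) y by apply: wrap_f_left; lra.
  by lra.
- move=> x y x12 y1; apply: wrap_growth => //; [lra | by right; lra |].
  have -> : - wrap_f N (x - 3) y = `|x - 3| * (wrap_q N (x - 3) + y / 4).
    by rewrite ler0_norm ?mulNr //; lra.
  by apply: wrap_f_growth; rewrite // ?ler0_norm; lra.
by move=> x y x34 _; apply: wrap_sink; lra.
Qed.

Lemma wrap_connection_left (i j : nat) : (j < 2)%N -> (j + n <= i + 2)%N -> (i < n)%N ->
  \forall eps \near (0 : R)^'+, exists X Y,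
    planar_orbit (fun x => eps * - P.[x]) (fun x y => - wrap_f N (x - pos j) y)
      (fun x y => wrap_g N (x - pos j) y) (pos i) (pos j) X Y.
Proof.
move=> j2 ji i_n; have j_n : (j < n)%N by move: n3; lia.
have kn : (0 < 2 * i + 1 < 2 * n)%N by lia.
have mn : (0 < 2 * j + 2 < 2 * n)%N by move: n3; lia.
have NN := N3.
have jiR : j%:R + N <= i%:R + 2 :> R by rewrite /N -[2]/(2%:R) -!natrD ler_nat.
have inR : i%:R + 1 <= N by rewrite /N -[1]/(1%:R) -natrD ler_nat addn1.
have jR0 : 0 <= j%:R :> R by exact: ler0n.
pose d : R := pos i - pos j.
have d1 : 2 * N - 4 <= d by rewrite /d !posE; lra.
have d2 : d <= 2 * N - 2 by rewrite /d !posE; lra.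
have [L L0 HL] := @drift_bound R n (2 * i + 1) (pos j) (pos i) kn.
have mE : pos j + 1 = (2 * j + 2)%:R :> R by rewrite posE natrD natrM; ring.
(* Reflection in [x] turns the motion to the left into one to the right and changes the sign of the
   drift. *)
pose p (x : R) := P.[- x].
have E := @small_drift_connection R p (fun x y => wrap_f N (- x - pos j) y)
  (fun x y => wrap_g N (- x - pos j) y) (- pos i) (- (pos j + 1)) (- (pos j + 1 / 4))
  (- pos j) (16 * N ^+ 2) ((5 * N) ^+ 6 / 16) (1 / 4) L (192 * (5 * N) ^+ 6 * N ^+ 4).
have cone x y : - pos i <= x <= - (pos j + 1) -> 0 <= y ->
    16 * N ^+ 2 * (x - - pos i) <= y ->
    [/\ 1 <= - x - pos j <= d, y / 8 <= wrap_q N (- x - pos j) + y / 4,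
    1 / 4 <= wrap_q N (- x - pos j) + y / 4 &
    1 / 4 <= N ^+ 2 * (y - 2) ^+ 2 + wrap_q N (- x - pos j)].
  move=> xi y0 xy.
  have u1 : 1 <= - x - pos j <= d by rewrite /d; lra.
  have [|q1 q2 q3] := @wrap_cone _ _ NN _ _ y d1 u1 y0; last by split.
  by have -> : d - (- x - pos j) = x - - pos i by rewrite /d; ring.
have {}E : \forall eps \near (0 : R)^'+, exists X Y, planar_orbit (fun x => eps * p x)
    (fun x y => wrap_f N (- x - pos j) y) (fun x y => wrap_g N (- x - pos j) y)
    (- pos i) (- pos j) X Y.
  apply: E => //.
  - by rewrite ltrN2; move: d1; rewrite /d; lra.
  - by rewrite ltrN2; lra.
  - by rewrite ltrN2; lra.
  - by rewrite mulr_gt0 ?exprn_gt0 //; lra.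
  - move=> x; apply: (@continuous_comp _ _ _ -%R (horner P)); last exact: continuous_horner.
    by apply: cvgN; exact: cvg_id.
  - exact: square_lipschitz_opp (square_lipschitz_hornerx P).
  - apply: square_lipschitz_opp (fun x y => wrap_f N (x - pos j) y) _.
    apply: square_lipschitz_ext (square_lipschitzM (square_lipschitz_cst (-1)) (lipf (pos j))) => x y.
    by rewrite mulN1r opprK.
  - exact: square_lipschitz_opp (lipg (pos j)).
  - by rewrite /p opprK drift_pos.
  - by rewrite /p opprK mE drift_root.
  - move=> x xi; have -> : x - - pos i = `|- x - pos i|.
      by rewrite ler0_norm; lra.
    by apply: HL; move: d1; rewrite /d; lra.
  - move=> x xj; apply: (@drift_gt0 _ _ j) => //.
    by rewrite -mE -/(pos j); lra.
  - move=> x y xi y0 xy; have [u1 _ q _] := cone x y xi y0 xy.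
    by rewrite /wrap_f; nra.
  - move=> x y xi y0 xy; have [u1 _ _ q] := cone x y xi y0 xy.
    by apply: wrap_g_ge => //; nra.
  - move=> x xi; have -> : x - - pos i = d - (- x - pos j) by rewrite /d; ring.
    by apply: wrap_edge => //; rewrite /d; lra.
  - move=> y y0; have -> : - - (pos j + 1) - pos j = 1 :> R by ring.
    by rewrite /wrap_f /wrap_q; lra.
  - by move=> x y xj y0; apply: wrap_f_le0; lra.
  - by move=> y; rewrite /wrap_f opprK subrr mul0r.
  - move=> x y xi y1 xy; have [|u1 q1 _ _] := cone x y xi _ xy; first by lra.
    apply: wrap_growth => //; [lra | by left; nra |].
    by rewrite /wrap_f; nra.
  - move=> x y xj y1; apply: wrap_growth => //; [lra | by right; lra |].
    have -> : wrap_f N (- x - pos j) y = `|- x - pos j| * (wrap_q N (- x - pos j) + y / 4).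
      by rewrite ger0_norm //; lra.
    by apply: wrap_f_growth; rewrite // ?ger0_norm; lra.
  by move=> x y xj _; apply: wrap_sink => //; lra.
apply: filterS E => eps [X [Y [dX dY Y0 [Xm Ym] [Xp Yp]]]].
exists (fun t => - X t), Y; split=> //.
- move=> t; have := dX t => ?; apply: is_derive_eq.
  by rewrite opprD -mulrN -mulrN.
- by split=> //; rewrite -[pos i]opprK; exact: cvgN.
- by split=> //; rewrite -[pos j]opprK; exact: cvgN.
Qed.

End WrapConnection.

(** * The system and the connections along the edges *)

Section RowCalculus.
Context {R : realType}.
Variable m : nat.
Implicit Types (M : R -> 'rV[R]_m) (A : 'rV[R]_m).

Lemma row_is_derive M A (t : R) :
  (forall k, is_derive t 1 (fun s => M s ord0 k) (A ord0 k)) -> is_derive t 1 M A.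
Proof.
move=> dM; have dd : derivable M t 1.
  by apply/derivable_mxP => i k; rewrite (ord1 i); case: (dM k).
apply: DeriveDef => //; rewrite derive_mx //; apply/rowP => k.
by rewrite mxE; case: (dM k).
Qed.

Lemma is_derive_entry M A (t : R) k :
  is_derive t 1 M A -> is_derive t 1 (fun s => M s ord0 k) (A ord0 k).
Proof.
move=> [dd <-]; apply: DeriveDef; first exact: (derivable_mxP _ _ _).1 dd _ _.
by rewrite derive_mx // mxE.
Qed.

Lemma row_cvg (F : set_system R) {FF : Filter F} M A :
  (forall k, M t ord0 k @[t --> F] --> A ord0 k) -> M t @[t --> F] --> A.
Proof.
move=> MA; apply/cvgrPdist_le => /= e e0; near=> t.
rewrite /Num.Def.normr/= mx_normrE (bigmax_le _ (ltW e0))//= => -[i k] _.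
rewrite (ord1 i) !mxE/=; move: k; near: t; apply: filter_forall => k.
exact: ((cvgrPdist_le _ _).1 (MA k)).
Unshelve. all: by end_near. Qed.

Lemma cvg_entry (F : set_system R) {FF : Filter F} M A k :
  M t @[t --> F] --> A -> M t ord0 k @[t --> F] --> A ord0 k.
Proof.
move=> MA; apply: (cvg_comp M (fun B : 'rV[R]_m => B ord0 k) MA).
exact: coord_continuous.
Qed.

End RowCalculus.

(* The only label that is stable at the node of index [j]. *)
Definition label (j : nat) : 'I_5 := inord (if (j < 2)%N then 3 + j else j %% 3)%N.

Lemma labelE j : label j = (if (j < 2)%N then 3 + j else j %% 3)%N :> nat.
Proof. by rewrite inordK //; case: ifP => ?; lia. Qed.

Section System.
Context {R : realType}.
Variable n : nat.
Hypothesis n3 : (3 <= n)%N.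
Let P : {poly R} := drift_poly n.

Definition sys_f (l : 'I_5) : {poly {poly R}} :=
  if (l < 3)%N then (mover_f n l)^:P else wrap_fpoly n (pos (l - 3)).

Definition sys_g (l : 'I_5) : {poly {poly R}} :=
  if (l < 3)%N then (mover_g n l)^:P else wrap_gpoly n (pos (l - 3)).

Definition field_f (l : nat) (x y : R) : R :=
  if (l < 3)%N then (mover_f n l).[x] else - wrap_f n%:R (x - pos (l - 3)) y.

Definition field_g (l : nat) (x y : R) : R :=
  if (l < 3)%N then (mover_g n l).[x] else wrap_g n%:R (x - pos (l - 3)) y.

Lemma sys_fE l x y : (sys_f l).[x, y] = field_f l x y.
Proof.
by rewrite /sys_f /field_f; case: ifP => _; rewrite ?wrap_fpolyE // horner_map hornerC.
Qed.

Lemma sys_gE l x y : (sys_g l).[x, y] = field_g l x y.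
Proof.
by rewrite /sys_g /field_g; case: ifP => _; rewrite ?wrap_gpolyE // horner_map hornerC.
Qed.

Lemma vector_fieldE eps (z : 'rV[R]_6) k : vector_field n sys_f sys_g eps z ord0 k =
  if unlift ord0 k is Some l
  then ycoord z l * field_g l (xcoord z) (ycoord z l)
  else eps * - P.[xcoord z] + \sum_l ycoord z l * field_f l (xcoord z) (ycoord z l).
Proof.
rewrite mxE; case: unlift => [l|]; first by rewrite sys_gE.
by rewrite drift_polyE mulrN mulNr; congr (_ + _); apply: eq_bigr => l _; rewrite sys_fE.
Qed.

(** The cases are those of [mover_connection], [wrap_connection_left] and
    [wrap_connection_right]. *)
Lemma dnn_val (i j : 'I_n) : dnn i j ->
  (2 <= j)%N && (j - 2 <= i < j)%N \/ (j < 2)%N /\ ((j + n <= i + 2)%N \/ i = 0%N :> nat /\ j = 1%N :> nat).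
Proof.
have i_n := ltn_ord i; have j_n := ltn_ord j.
have S (k : nat) : (k < n)%N -> (k.+1 %% n = if k.+1 == n then 0 else k.+1)%N.
  move=> kn; case: eqP => [->|ne]; first by rewrite modnn.
  by rewrite modn_small //; lia.
move=> /orP[] /eqP /(congr1 val) /=; first by rewrite (S i) //; case: eqP; lia.
rewrite (S (i.+1 %% n)%N); last by rewrite ltn_pmod //; lia.
by rewrite (S i) //; case: (i.+1 =P n); case: eqP; lia.
Qed.

Lemma edge_orbit (i j : 'I_n) : dnn i j ->
  \forall eps \near (0 : R)^'+, exists X Y,
    planar_orbit (fun x => eps * - P.[x]) (field_f (label j)) (field_g (label j))
      (pos i) (pos j) X Y.
Proof.
move=> /dnn_val [/andP[j2 ij]|[j2 [ji|[i0 j1]]]].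
- have j2' : (j < 2)%N = false by rewrite ltnNge j2.
  have -> : field_f (label j) = fun x _ => (mover_f n (j %% 3)).[x].
    by apply/funext => x; apply/funext => y; rewrite /field_f labelE j2' ltn_pmod.
  have -> : field_g (label j) = fun x _ => (mover_g n (j %% 3)).[x].
    by apply/funext => x; apply/funext => y; rewrite /field_g labelE j2' ltn_pmod.
  by apply: mover_connection => //; rewrite j2 ltn_ord.
- have -> : field_f (label j) = fun x y => - wrap_f n%:R (x - pos j) y.
    by apply/funext => x; apply/funext => y; rewrite /field_f labelE j2 /= addnC addnK.
  have -> : field_g (label j) = fun x y => wrap_g n%:R (x - pos j) y.
    by apply/funext => x; apply/funext => y; rewrite /field_g labelE j2 /= addnC addnK.
  exact: wrap_connection_left.
rewrite i0 j1.
have -> : field_f (label 1) = fun x y => - wrap_f n%:R (x - pos 1) y.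
  by apply/funext => x; apply/funext => y; rewrite /field_f labelE.
have -> : field_g (label 1) = fun x y => wrap_g n%:R (x - pos 1) y.
  by apply/funext => x; apply/funext => y; rewrite /field_g labelE.
exact: wrap_connection_right.
Qed.

Lemma lift_orbit (eps : R) (l : 'I_5) (i j : 'I_n) (X Y : R -> R) :
  planar_orbit (fun x => eps * - P.[x]) (field_f l) (field_g l) (pos i) (pos j) X Y ->
  exists phi, connection (@phase_space R 5) (vector_field n sys_f sys_g eps)
    (@node R 5 n i) (@node R 5 n j) phi.
Proof.
move=> [dX dY Y0 [Xm Ym] [Xp Yp]].
pose phi t : 'rV[R]_6 := \row_k
  if unlift ord0 k is Some l' then (if l' == l then Y t else 0) else X t.
have xE t : xcoord (phi t) = X t by rewrite /xcoord mxE unlift_none.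
have yE t l' : ycoord (phi t) l' = if l' == l then Y t else 0.
  by rewrite /ycoord mxE liftK.
have node_cvg (F : set_system R) (FF : Filter F) (k : 'I_n) :
    X t @[t --> F] --> (pos k : R) -> Y t @[t --> F] --> (0 : R) -> phi t @[t --> F] --> @node R 5 n k.
  move=> XF YF; apply: row_cvg => h; rewrite mxE.
  case: (unliftP ord0 h) => [l' ->|->].
    rewrite eq_sym (negbTE (neq_lift _ _)).
    under eq_fun do rewrite mxE liftK.
    by case: eqP => _; [exact: YF | exact: cvg_cst].
  by under eq_fun do rewrite mxE unlift_none; rewrite eqxx; exact: XF.
exists phi; split; [ | | exact: node_cvg | exact: node_cvg].
- move=> t; split.
    by move=> l'; rewrite yE; case: eqP => // _; exact: ltW.
  apply: row_is_derive => k; rewrite vector_fieldE.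
  case: (unliftP ord0 k) => [l' ->|->].
    rewrite xE yE; under eq_fun do rewrite mxE liftK.
    case: eqP => [->|_]; first exact: dY.
    by rewrite mul0r; exact: is_derive_cst.
  rewrite xE; under eq_fun do rewrite mxE unlift_none.
  rewrite (bigD1 l) //= big1 ?addr0; last first.
    by move=> l' /negbTE l'l; rewrite yE l'l mul0r.
  by rewrite yE eqxx; exact: dX.
- have e0 : 0 < Y 0 / 2 by rewrite divr_gt0.
  move/cvgrPdist_lt : Yp => /(_ _ e0) [M [_ HM]].
  exists 0, (`|M| + 1) => eqphi.
  have := yE 0 l; rewrite eqphi yE eqxx => YY.
  have /HM /= : M < `|M| + 1 by have := ler_norm M; lra.
  by rewrite sub0r normrN gtr0_norm // YY; have := Y0 0; lra.
Qed.

End System.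

(** * Absence of further connections *)

Section Barriers.
Context {R : realType}.

(** With the integrating factor [expR (- H)] the solution becomes constant, also for unbounded [h].
    This serves for the faces [y_l = 0] and for the walls. *)
Lemma linear_stays_pos (u h : R -> R) : continuous h ->
  (forall t : R, is_derive t 1 u (u t * h t)) -> forall s, 0 < u s -> forall t, 0 < u t.
Proof.
move=> ch du s us t; have [H _ dH] := continuous_primitive ch.
have dv (r : R) : is_derive r 1 (fun r => u r * expR (- H r)) 0.
  have := du r; have := dH r => ? ?.
  by apply: is_derive_eq; rewrite /GRing.scale/=; ring.
have := is_derive_0_is_cst s t dv => E.
have : 0 < u t * expR (- H t) by rewrite -E mulr_gt0 ?expR_gt0.
by rewrite pmulr_lgt0 ?expR_gt0.
Qed.

Lemma cvg_square_lipschitz (h : R -> R -> R) (F : set_system R) {FF : Filter F}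
    (X Y : R -> R) (a b : R) : square_lipschitz h ->
  X t @[t --> F] --> a -> Y t @[t --> F] --> b -> h (X t) (Y t) @[t --> F] --> h a b.
Proof.
move=> lh Xa Yb; apply/cvgrPdist_le => /= e e0.
pose B := `|a| + `|b| + 1.
have B0 : 0 < B by rewrite /B ltr_wpDl // addr_ge0.
have [L [_ [L0 _ _ HL]]] := lh B B0.
have e1 : 0 < e / (L + 1) / 2 by rewrite !divr_gt0 // ltr_wpDl.
near=> t.
have X1 : `|a - X t| <= 1 by near: t; exact: cvgr_dist_le Xa _ ltr01.
have Y1 : `|b - Y t| <= 1 by near: t; exact: cvgr_dist_le Yb _ ltr01.
have X2 : `|a - X t| <= e / (L + 1) / 2 by near: t; exact: cvgr_dist_le Xa _ e1.
have Y2 : `|b - Y t| <= e / (L + 1) / 2 by near: t; exact: cvgr_dist_le Yb _ e1.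
have tri (p q : R) : `|q| <= `|p| + `|p - q|.
  by have := ler_normB p (p - q); rewrite opprB addrC subrK.
have XB := tri a (X t); have YB := tri b (Y t).
have a0 := normr_ge0 a; have b0 := normr_ge0 b.
have sq1 : square B a b by split; rewrite /B; lra.
have sq2 : square B (X t) (Y t) by split; rewrite /B; lra.
apply: (le_trans (HL _ _ _ _ sq1 sq2)).
have : L * (e / (L + 1)) <= e by rewrite mulrA ler_pdivrMr ?ltr_wpDl //; nra.
by apply: le_trans; rewrite ler_wpM2l //; lra.
Unshelve. all: by end_near. Qed.

Lemma growth_not_null (u u' : R -> R) : (forall t : R, is_derive t 1 u (u' t)) ->
  (forall t, 0 < u t) -> u t @[t --> +oo] --> (0 : R) ->
  ~ (\forall t \near +oo, 0 <= u' t).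
Proof.
move=> du u0 ulim [M [_ HM]].
pose t0 := `|M| + 1.
have Mt0 : M < t0 by rewrite /t0; have := ler_norm M; lra.
move/cvgrPdist_lt : ulim => /(_ _ (u0 t0)) [M' [_ HM']].
pose t1 := t0 + `|M'| + 1.
have M0 := normr_ge0 M'.
have : u t0 <= u t1.
  apply: (derive_ge0_le du); first by rewrite /t1; lra.
  by move=> t /andP[t0t _]; apply: HM; exact: lt_trans t0t.
have /HM' /= : M' < t1 by rewrite /t1; have := ler_norm M'; have := normr_ge0 M; rewrite /t0; lra.
by rewrite sub0r normrN gtr0_norm //; lra.
Qed.

Lemma decay_not_null (u u' : R -> R) : (forall t : R, is_derive t 1 u (u' t)) ->
  (forall t, 0 < u t) -> u t @[t --> -oo] --> (0 : R) ->
  ~ (\forall t \near -oo, u' t <= 0).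
Proof.
move=> du u0 ulim [M [_ HM]].
pose t0 := - `|M| - 1.
have Mt0 : t0 < M by rewrite /t0; have := ler_norm (- M); rewrite normrN; lra.
move/cvgrPdist_lt : ulim => /(_ _ (u0 t0)) [M' [_ HM']].
pose t1 := t0 - `|M'| - 1.
have M0 := normr_ge0 M'.
have dNu (t : R) : is_derive t 1 (fun t => - u t) (- u' t) by exact: is_deriveN.
have : - u t1 <= - u t0.
  apply: (derive_ge0_le dNu); first by rewrite /t1; lra.
  by move=> t /andP[_ tt0]; rewrite oppr_ge0; apply: HM; exact: lt_trans Mt0.
have /HM' /= : t1 < M'.
  by rewrite /t1; have := ler_norm (- M'); rewrite normrN; have := normr_ge0 M; rewrite /t0; lra.
by rewrite sub0r normrN gtr0_norm //; lra.
Qed.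

(** In the distant past [x] is above the level [a - e], and for small [e] this level is crossed only
    upwards. *)
Lemma lower_barrier (x x' : R -> R) (a : R) : (forall t : R, is_derive t 1 x (x' t)) ->
  (forall t, a - 1 < x t < a -> 0 < x' t) -> x t @[t --> -oo] --> a ->
  forall t, a <= x t.
Proof.
move=> dx up xa t0; rewrite leNgt; apply/negP => xt0.
pose e := Num.min ((a - x t0) / 2) (1 / 2).
have e0 : 0 < e by rewrite lt_min !divr_gt0 ?subr_gt0.
have e1 : e <= (a - x t0) / 2 by rewrite ge_min lexx.
have e2 : e <= 1 / 2 by rewrite ge_min lexx orbT.
move/cvgrPdist_lt : xa => /(_ _ e0) [M [_ HM]].
pose t1 := Num.min t0 M - 1.
have m1 : Num.min t0 M <= t0 by rewrite ge_min lexx.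
have m2 : Num.min t0 M <= M by rewrite ge_min lexx orbT.
have t10 : t1 <= t0 by rewrite /t1; lra.
have /HM /= : t1 < M by rewrite /t1; lra.
have := ler_norm (a - x t1) => n1 n2.
have : a - e <= x t0; last by lra.
apply: (upcrossing dx t10) => [t _ xt|]; last by lra.
by apply: up; rewrite xt; apply/andP; split; lra.
Qed.

Lemma first_exit (u : R -> R) (a b : R) : continuous u -> a <= b -> 0 < u a -> u b <= 0 ->
  exists c, [/\ a < c <= b, u c = 0 & forall t, a <= t < c -> 0 < u t].
Proof.
move=> cu ab ua ub; pose v t := - u (- t).
have cv : continuous v.
  move=> t; apply: cvgN; apply: (@continuous_comp _ _ _ -%R u); last exact: cu.
  by apply: cvgN; exact: cvg_id.
have [|||c [/andP[bc ca] vc after]] := @last_crossing R v (- b) (- a) 0 cv.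
- by rewrite lerN2.
- by rewrite /v opprK oppr_ge0.
- by rewrite /v opprK oppr_lt0.
exists (- c); split.
- by apply/andP; split; lra.
- by apply/eqP; rewrite -oppr_eq0; apply/eqP.
move=> t /andP[at_ tc]; have := after (- t); rewrite /v opprK oppr_lt0; apply.
by apply/andP; split; lra.
Qed.

Lemma derive_pos_before (u : R -> R) (d c a : R) : is_derive c 1 u d -> 0 < d -> a < c ->
  exists2 t, a <= t < c & u t < u c.
Proof.
move=> du d0 ac.
have dv : is_derive (- c) 1 (fun t => - u (- t)) d.
  have dc : is_derive (- - c) 1 u d by rewrite opprK.
  have := is_derive1_comp (f := u) (g := -%R) (x := - c) => /(_ _ _ dc (is_deriveNid _ _)) H.
  by apply: is_derive_eq; rewrite mulrN1 opprK.
have [|t /andP[ct ta]] := @derive_pos_increases R _ d (- c) (- a) dv d0; first by rewrite ltrN2.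
rewrite opprK ltrN2 => ut; exists (- t) => //.
by apply/andP; split; lra.
Qed.

(* The three constraints may vanish together at a corner of the region, where
   only one of the three derivatives needs to be positive. *)
Lemma trapped3 (u1 u2 u3 d1 d2 d3 : R -> R) (a : R) :
  (forall t : R, is_derive t 1 u1 (d1 t)) -> (forall t : R, is_derive t 1 u2 (d2 t)) ->
  (forall t : R, is_derive t 1 u3 (d3 t)) ->
  0 < u1 a -> 0 < u2 a -> 0 < u3 a ->
  (forall t, 0 <= u1 t -> 0 <= u2 t -> 0 <= u3 t -> [\/ u1 t = 0, u2 t = 0 | u3 t = 0] ->
    [\/ u1 t = 0 /\ 0 < d1 t, u2 t = 0 /\ 0 < d2 t | u3 t = 0 /\ 0 < d3 t]) ->
  forall t, a <= t -> 0 < u1 t.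
Proof.
move=> D1 D2 D3 a1 a2 a3 edge t at_; rewrite ltNge; apply/negP => u1t.
pose u r := Num.min (u1 r) (Num.min (u2 r) (u3 r)).
have cu : continuous u.
  move=> r; apply: (@continuous_min R R u1 (u2 \min u3)).
    exact: is_derive_continuous (D1 r).
  by apply: (@continuous_min R R u2 u3);
    [exact: is_derive_continuous (D2 r) | exact: is_derive_continuous (D3 r)].
have ua : 0 < u a by rewrite !lt_min a1 a2.
have ut : u t <= 0 by rewrite ge_min u1t.
have [c [/andP[ac ct] uc before]] := first_exit cu at_ ua ut.
have uP r : u r = 0 -> [/\ 0 <= u1 r, 0 <= u2 r, 0 <= u3 r & [\/ u1 r = 0, u2 r = 0 | u3 r = 0]].
  rewrite /u; case: (leP (u2 r) (u3 r)) => h1; case: (leP (u1 r)) => h2 e; split;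
    by [lra | apply: Or31 | apply: Or32 | apply: Or33].
have [p1 p2 p3 pe] := uP c uc.
have no (v d : R -> R) : (forall t : R, is_derive t 1 v (d t)) -> (forall r, u r <= v r) ->
    v c = 0 -> ~ 0 < d c.
  move=> dv uv vc dc; have [r rc] := derive_pos_before (dv c) dc ac.
  by rewrite vc ltNge (le_trans _ (uv r)) // ltW // before.
case: (edge c p1 p2 p3 pe) => -[e]; apply: no e; rewrite // => r.
- by rewrite ge_min lexx.
- by rewrite !ge_min lexx orbT.
- by rewrite !ge_min lexx !orbT.
Qed.

End Barriers.

(** * Every connection follows an edge *)

Section Nonexistence.
Context {R : realType}.
Variable n : nat.
Hypothesis n3 : (3 <= n)%N.
Let P : {poly R} := drift_poly n.
Let F := @vector_field R 5 n (sys_f n) (sys_g n).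

Lemma label_eq (l : 'I_5) (j : nat) : l = label j <->
  (if (l < 3)%N then (2 <= j)%N && (j %% 3 == l)%N else (l == 3 + j :> nat)%N).
Proof.
have l5 := ltn_ord l; have jE := labelE j; split=> [->|H].
  by move: jE; case: (ltnP j 2) => j2 jE; case: (ltnP (label j) 3) => l3; lia.
apply/val_inj; move: jE H => /=.
by case: (ltnP j 2) => j2 jE; case: (ltnP l 3) => l3; lia.
Qed.

(** For the labels 3 and 4, the term [N ^+ 2 * (y - 2) ^+ 2] equals [4 * N ^+ 2] at [y = 0] and
    outweighs the minimum [- (N - 3) ^+ 2] of [wrap_q]. *)
Lemma field_g_node (l : 'I_5) (j : nat) : (j < n)%N ->
  if l == label j then field_g n l (pos j : R) 0 < 0 else 0 < field_g n l (pos j : R) 0.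
Proof.
move=> jn; have NN : 3 <= n%:R :> R by rewrite ler_nat.
have M0 : 0 < (5 * n%:R) ^+ 6 :> R by rewrite exprn_gt0 //; lra.
case: eqP => [->|lj]; rewrite /field_g.
  rewrite labelE; case: (ltnP j 2) => j2 /=.
    rewrite addnC addnK subrr; have := @wrap_sink R n%:R NN 0 0.
    by have := M0; lra.
  by rewrite ltn_pmod //; apply: (@mover_g_lt0 _ _ _ _ j) => //; rewrite ?j2 //; lra.
have {}lj : ~ (if (l < 3)%N then (2 <= j)%N && (j %% 3 == l)%N else (l == 3 + j :> nat)%N).
  by move/label_eq.
case: ltnP lj => l3 lj.
  apply: mover_g_gt0 => u un ul.
  have [uj|ju] : (u + 1 <= j)%N \/ (j + 1 <= u)%N by lia.
    left; have : (u + 1)%:R <= j%:R :> R by rewrite ler_nat.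
    by rewrite !posE natrD; lra.
  right; have : (j + 1)%:R <= u%:R :> R by rewrite ler_nat.
  by rewrite !posE natrD; lra.
set u := pos j - pos (l - 3).
have u4 : 4 <= u ^+ 2.
  have [uj|ju] : (l - 3 + 1 <= j)%N \/ (j + 1 <= l - 3)%N by move/eqP: lj; lia.
    have : (l - 3 + 1)%:R <= j%:R :> R by rewrite ler_nat.
    by rewrite /u !posE natrD; nra.
  have : (j + 1)%:R <= (l - 3)%:R :> R by rewrite ler_nat.
  by rewrite /u !posE natrD; nra.
have q := @wrap_q_ge R n%:R u.
rewrite /wrap_g; apply: mulr_gt0; first by apply: mulr_gt0 => //; lra.
by rewrite sub0r sqrrN; move: (n%:R : R) NN q => N N3 q; nra.
Qed.

Lemma square_lipschitz_field_g (l : 'I_5) : square_lipschitz (@field_g R n l).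
Proof.
by apply: square_lipschitz_ext (square_lipschitz_horner2 (sys_g n l)) => x y; rewrite sys_gE.
Qed.

Lemma field_f_ge0 (l : 'I_5) (x y : R) : (l < 3)%N -> 0 <= field_f n l x y.
Proof. by rewrite /field_f => ->; exact: mover_f_ge0. Qed.

Section Trajectory.
Variables (eps : R) (phi : R -> 'rV[R]_6) (i j : 'I_n).
Hypotheses (eps0 : 0 < eps) (phiC : connection (@phase_space R 5) (F eps)
  (@node R 5 n i) (@node R 5 n j) phi).

Let x t := xcoord (phi t).
Let y l t := ycoord (phi t) l.

Let y_ge0 l t : 0 <= y l t.
Proof. by case: phiC => /(_ t) [H _] _ _ _; exact: H. Qed.

Let dx (t : R) : is_derive t 1 x (eps * - P.[x t] + \sum_l y l t * field_f n l (x t) (y l t)).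
Proof.
case: phiC => /(_ t) [_ H] _ _ _; have := is_derive_entry ord0 H.
by rewrite vector_fieldE unlift_none.
Qed.

Let dy l (t : R) : is_derive t 1 (y l) (y l t * field_g n l (x t) (y l t)).
Proof.
case: phiC => /(_ t) [_ H] _ _ _; have := is_derive_entry (lift ord0 l) H.
by rewrite vector_fieldE liftK.
Qed.

Let node0 (k : 'I_n) : @node R 5 n k ord0 ord0 = pos k.
Proof. by rewrite mxE eqxx. Qed.

Let nodey (k : 'I_n) l : @node R 5 n k ord0 (lift ord0 l) = 0.
Proof. by rewrite mxE eq_sym (negbTE (neq_lift _ _)). Qed.

Let x_alpha : x t @[t --> -oo] --> (pos i : R).
Proof. by case: phiC => _ _ H _; rewrite -(node0 i); exact: (cvg_entry (k := ord0) H). Qed.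

Let x_omega : x t @[t --> +oo] --> (pos j : R).
Proof. by case: phiC => _ _ _ H; rewrite -(node0 j); exact: (cvg_entry (k := ord0) H). Qed.

Let y_alpha l : y l t @[t --> -oo] --> (0 : R).
Proof. by case: phiC => _ _ H _; rewrite -(nodey i l); exact: (cvg_entry (k := lift ord0 l) H). Qed.

Let y_omega l : y l t @[t --> +oo] --> (0 : R).
Proof. by case: phiC => _ _ _ H; rewrite -(nodey j l); exact: (cvg_entry (k := lift ord0 l) H). Qed.

Let cx : continuous x. Proof. by move=> t; exact: is_derive_continuous (dx t). Qed.
Let cy l : continuous (y l). Proof. by move=> t; exact: is_derive_continuous (dy l t). Qed.

Let y_pos l s : 0 < y l s -> forall t, 0 < y l t.
Proof.
apply: (@linear_stays_pos R (y l) (fun t => field_g n l (x t) (y l t))) => [t|t].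
  apply: (@cvg_square_lipschitz R (field_g n l) (nbhs t) _ x (y l) (x t) (y l t)).
  - exact: square_lipschitz_field_g.
  - exact: cx.
  - exact: cy.
exact: dy.
Qed.

Let y_zero l : ~~ (0 < y l 0) -> forall t, y l t = 0.
Proof.
move=> yl0 t; apply/eqP; rewrite eq_le y_ge0 andbT leNgt.
by apply: contra yl0 => ylt; exact: y_pos ylt 0.
Qed.

(** Near a node of its own label [y_l] decays, so it would have been larger in the past instead of
    coming from 0. *)
Let active_source l : 0 < y l 0 -> l != label i.
Proof.
move=> yl; apply/eqP => li.
have := field_g_node l (ltn_ord i); rewrite li eqxx -li => neg.
apply: (decay_not_null (dy l) (y_pos yl) (@y_alpha l)).
have lim : field_g n l (x t) (y l t) @[t --> -oo] --> field_g n l (pos i : R) 0.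
  by apply: cvg_square_lipschitz; [exact: square_lipschitz_field_g | exact: x_alpha |].
apply: filterS (cvgr_lt _ lim _ neg) => t gt.
by rewrite mulr_ge0_le0 // ltW.
Qed.

Let active_target l : 0 < y l 0 -> l = label j.
Proof.
move=> yl; apply/eqP; apply: contraT => lj.
have := field_g_node l (ltn_ord j); rewrite (negbTE lj) => gpos.
case: (growth_not_null (dy l) (y_pos yl) (@y_omega l)).
have lim : field_g n l (x t) (y l t) @[t --> +oo] --> field_g n l (pos j : R) 0.
  by apply: cvg_square_lipschitz; [exact: square_lipschitz_field_g | exact: x_omega |].
apply: filterS (cvgr_gt _ lim _ gpos) => t gt.
by rewrite mulr_ge0 // ltW.
Qed.

Let drift_pushes_right t : pos i - 1 < x t < pos i -> 0 < eps * - P.[x t].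
Proof.
move=> xt; rewrite mulr_gt0 // oppr_gt0; apply: (@drift_lt0 _ _ i) => //.
by move: xt; rewrite /pos natrD addrK.
Qed.

Let x_ge : (forall l t, 0 <= y l t * field_f n l (x t) (y l t)) -> forall t, pos i <= x t.
Proof.
move=> f0; apply: (lower_barrier dx _ x_alpha) => t xt.
by rewrite ltr_wpDr ?drift_pushes_right // sumr_ge0.
Qed.

(** On the axis the source attracts from both sides, so an orbit with this alpha-limit would be
    constant. *)
Lemma connection_active : exists l, 0 < y l 0.
Proof.
apply: contrapT => none.
have y0 l t : y l t = 0.
  by apply: y_zero; apply/negP => yl; apply: none; exists l.
have xge : forall t, pos i <= x t by apply: x_ge => l t; rewrite y0 mul0r.
have dxN (t : R) : is_derive t 1 (fun t => - x t) (eps * P.[x t]).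
  have H := is_deriveN (dx t); apply: is_derive_eq H _.
  rewrite big1 ?addr0 ?mulrN ?opprK // => l _; by rewrite y0 mul0r.
have xle t : - pos i <= - x t.
  apply: (lower_barrier dxN) => [r xr|]; last by apply: cvgN; exact: x_alpha.
  rewrite mulr_gt0 //; apply: (@drift_gt0 _ _ i) => //.
  have -> : (2 * i + 2)%:R = pos i + 1 :> R by rewrite posE natrD natrM; ring.
  by rewrite -/(pos i); lra.
case: phiC => _ [s [t st]] _ _; apply: st; apply/rowP => k.
have xs r : x r = pos i by apply/eqP; rewrite eq_le xge andbT -lerN2.
case: (unliftP ord0 k) => [l ->|->]; last exact: etrans (xs s) (esym (xs t)).
exact: etrans (y0 l s) (esym (y0 l t)).
Qed.

Let l0 := label j.

Let only_l0 l t : l != l0 -> y l t = 0.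
Proof. by move=> ll0; apply: y_zero; apply: contra ll0 => /active_target ->. Qed.

Let l0_pos t : 0 < y l0 t.
Proof.
have [l yl] := connection_active.
by rewrite /l0 -(active_target yl); exact: y_pos yl t.
Qed.

Let ij : label i != label j.
Proof. by rewrite eq_sym; apply: active_source; exact: l0_pos. Qed.

Let dx0 (t : R) : is_derive t 1 x (eps * - P.[x t] + y l0 t * field_f n l0 (x t) (y l0 t)).
Proof.
have H := dx t; apply: is_derive_eq H _; congr (_ + _).
rewrite (bigD1 l0) //= big1 ?addr0 // => l ll0.
by rewrite only_l0 // mul0r.
Qed.

(** Dividing the drift and [f] by [x - b] exhibits a linear equation for [b - x], which therefore
    keeps its sign. *)
Let wall_stops (b : R) (q : {poly R}) : (forall x y, field_f n l0 x y = q.[x]) ->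
  P.[b] = 0 -> q.[b] = 0 -> ~ (pos i < b < pos j).
Proof.
move=> fq Pb qb /andP[ib bj].
have /factor_theorem [P1 P1E] : root P b by apply/eqP.
have /factor_theorem [q1 q1E] : root q b by apply/eqP.
pose h t := - (eps * P1.[x t]) + y l0 t * q1.[x t].
have ch : continuous h.
  move=> t; apply: cvgD.
    apply: cvgN; apply: cvgM; first exact: cvg_cst.
    by apply: (@continuous_comp _ _ _ x (horner P1)); [exact: cx | exact: continuous_horner].
  apply: cvgM; first exact: cy.
  by apply: (@continuous_comp _ _ _ x (horner q1)); [exact: cx | exact: continuous_horner].
have du (t : R) : is_derive t 1 (fun t => b - x t) ((b - x t) * h t).
  have H := is_deriveB (is_derive_cst b t 1) (dx0 t); apply: is_derive_eq H _.
  by rewrite fq P1E q1E !hornerM !hornerXsubC /h; ring.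
have [t1 ut1] : exists t, 0 < b - x t.
  have [M [_ HM]] := cvgr_lt _ x_alpha _ ib.
  exists (M - 1); rewrite subr_gt0; apply: HM; lra.
have [t2 ut2] : exists t, b - x t <= 0.
  have [M [_ HM]] := cvgr_gt _ x_omega _ bj.
  exists (M + 1); rewrite subr_le0 ltW //; apply: HM; lra.
by have := linear_stays_pos ch du ut1 t2; rewrite ltNge ut2.
Qed.

(** As [f >= 0], an orbit never falls below its source. Sources too far away are cut off by the node
    of index [j - 3] if [j >= 5], and by the extra root if [j] is 3 or 4. A source at that node has
    the label of the target, which [ij] forbids. *)
Let mover_target : (2 <= j)%N -> (i < j <= i + 2)%N.
Proof.
move=> j2.
have l0E : l0 = (j %% 3)%N :> nat by rewrite labelE ltnNge j2.
have l03 : (l0 < 3)%N by rewrite l0E ltn_pmod.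
have fE x' y' : field_f n l0 x' y' = (mover_f n l0).[x'] by rewrite /field_f l03.
have xge : forall t, pos i <= x t.
  apply: x_ge => l t; have [->|ll0] := eqVneq l l0; last by rewrite only_l0 ?mul0r.
  by rewrite mulr_ge0 ?field_f_ge0.
have ijle : (i <= j)%N.
  rewrite -(@pos_le R) leNgt; apply/negP => ji.
  have [M [_ HM]] := cvgr_lt _ x_omega _ ji.
  have /HM : M < M + 1 by lra.
  by rewrite ltNge xge.
have ijne : i != j :> nat by apply: contra ij => /eqP ->.
rewrite ltn_neqAle ijne ijle /= leqNgt; apply/negP => far.
have jn := ltn_ord j.
have [j5|j4] := leqP 5 j.
  apply: (@wall_stops (pos (j - 3)) (mover_f n l0)) => //.
  - by apply: drift_pos; lia.
  - by apply: mover_f_root; lia.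
  rewrite !pos_lt; apply/andP; split; last by lia.
  have : (i : nat) != (j - 3)%N.
    apply: contra ij => /eqP iE; apply/eqP/ord_inj.
    move: (labelE i) (labelE j); rewrite iE.
    by case: (ltnP (j - 3) 2) => ?; case: (ltnP j 2) => ?; lia.
  by lia.
apply: (@wall_stops (2 * l0 + 2)%:R (mover_f n l0)) => //.
- by apply: drift_root; lia.
- exact: mover_f_root_wall.
by rewrite /pos !ltr_nat; lia.
Qed.

Let wrap_target : (j < 2)%N -> (i < j)%N || (j + n <= i + 2)%N.
Proof.
move=> j2; apply/orP; have [ni|ni] := leqP (j + n) (i + 2); first by right.
left; rewrite ltnNge; apply/negP => ji.
have i_n := ltn_ord i.
have ijne : i != j :> nat by apply: contra ij => /eqP ->.
have NN : 3 <= n%:R :> R by rewrite ler_nat.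
(* The right side [u = 2 n - 5] of the box is the even integer [k], a root of the drift, so the
   drift does not push orbits out there. *)
pose k := (2 * j + 2 * n - 4)%N.
have k4 : (k + 4 = 2 * j + 2 * n)%N by rewrite /k; lia.
have kn : (0 < k < 2 * n)%N by rewrite /k; lia.
have j1n : (j.+1 < n)%N by lia.
have ji1 : (j + 1)%:R <= i%:R :> R by rewrite ler_nat; lia.
have ni1 : (i + 3)%:R <= (j + n)%:R :> R by rewrite ler_nat; lia.
rewrite !natrD in ji1 ni1.
have l0E : l0 = (3 + j)%N :> nat by rewrite labelE j2.
have fE x' y' : field_f n l0 x' y' = - wrap_f n%:R (x' - pos j) y'.
  by rewrite /field_f l0E /= addnC addnK.
have gE x' y' : field_g n l0 x' y' = wrap_g n%:R (x' - pos j) y'.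
  by rewrite /field_g l0E /= addnC addnK.
pose N : R := n%:R; pose ell := 2 * N - 5.
have M0 : 0 < (5 * N) ^+ 6 by rewrite exprn_gt0 // /N; lra.
have D1 (t : R) : is_derive t 1 (fun t => x t - (pos j + 3 / 2))
    (eps * - P.[x t] + y l0 t * - wrap_f N (x t - pos j) (y l0 t)).
  have H := is_deriveB (dx0 t) (is_derive_cst (pos j + 3 / 2) t 1).
  by apply: is_derive_eq H _; rewrite fE subr0.
have D2 (t : R) : is_derive t 1 (fun t => pos j + ell - x t)
    (- (eps * - P.[x t] + y l0 t * - wrap_f N (x t - pos j) (y l0 t))).
  have H := is_deriveB (is_derive_cst (pos j + ell) t 1) (dx0 t).
  by apply: is_derive_eq H _; rewrite fE sub0r.
have D3 (t : R) : is_derive t 1 (fun t => 2 - y l0 t)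
    (- (y l0 t * wrap_g N (x t - pos j) (y l0 t))).
  have H := is_deriveB (is_derive_cst (2 : R) t 1) (dy l0 t).
  by apply: is_derive_eq H _; rewrite gE sub0r.
(* Middle nodes lie at even [u] from 2 to [2 n - 6], so all points within 1/2 of one satisfy the
   bounds on [u]. *)
have [t0 [in1 in2 in3]] : exists t, [/\ 0 < x t - (pos j + 3 / 2),
    0 < pos j + ell - x t & 0 < 2 - y l0 t].
  have e1 : 0 < 1 / 2 :> R by [].
  move: x_alpha => /cvgrPdist_lt /(_ _ e1) [M1 [_ H1]].
  have e2 : 0 < 2 :> R by [].
  have [M2 [_ H2]] := cvgr_lt _ (@y_alpha l0) _ e2.
  have m1 : Num.min M1 M2 <= M1 by rewrite ge_min lexx.
  have m2 : Num.min M1 M2 <= M2 by rewrite ge_min lexx orbT.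
  exists (Num.min M1 M2 - 1).
  have /H1 /= : Num.min M1 M2 - 1 < M1 by lra.
  have /H2 /= : Num.min M1 M2 - 1 < M2 by lra.
  rewrite /ell !posE ltr_norml => yy /andP[xx1 xx2].
  by split; lra.
have ell3 : 3 <= ell by rewrite /ell /N; lra.
have stay t : t0 <= t -> 0 < x t - (pos j + 3 / 2).
  apply: (trapped3 D1 D2 D3 in1 in2 in3) => {}t u1 u2 u3 zero.
  have y0 := l0_pos t.
  (* Corners are assigned to the vertical sides, because at [u = ell], [y = 2] the derivative of [y]
     vanishes. On the right side [wrap_q] is 0 and the term [y / 4] pushes left; on the left side
     drift and push both point inwards. *)
  have [B|B] := eqVneq (pos j + ell - x t) 0.
    apply: Or32; split=> //.
    have kE : k%:R = pos j + ell.
      have : (k + 4)%:R = (2 * j + 2 * n)%:R :> R by rewrite k4.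
      by rewrite posE /ell /N natrD (natrD _ (2 * j)) !natrM; lra.
    have xE : x t = k%:R by rewrite kE; lra.
    have -> : P.[x t] = 0 by rewrite xE drift_root.
    rewrite oppr0 mulr0 add0r -mulrN opprK.
    have -> : x t - pos j = ell by lra.
    rewrite /wrap_f /wrap_q -/ell subrr mulr0 add0r.
    by rewrite mulr_gt0 // mulr_gt0 ?divr_gt0 //; lra.
  have B' : x t - pos j < ell.
    by have : 0 < pos j + ell - x t; [rewrite lt_neqAle eq_sym B | lra].
  have [A|A] := eqVneq (x t - (pos j + 3 / 2)) 0.
    apply: Or31; split=> //.
    have xE : x t - pos j = 3 / 2 by lra.
    have dr : 0 < - P.[x t].
      rewrite oppr_gt0; apply: (@drift_lt0 _ _ j.+1) => //.
      have -> : x t = pos j + 3 / 2 by lra.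
      by rewrite natrD natrM -(natr1 j) posE; apply/andP; split; lra.
    have : 0 < eps * - P.[x t] by rewrite mulr_gt0.
    suff : 0 <= y l0 t * - wrap_f N (x t - pos j) (y l0 t) by lra.
    rewrite mulr_ge0 ?(ltW y0) // xE /wrap_f /wrap_q -/ell.
    by lra.
  have D : 2 - y l0 t = 0.
    by case: zero => // e; [move: A | move: B]; rewrite e eqxx.
  apply: Or33; split=> //.
  have -> : y l0 t = 2 by lra.
  rewrite oppr_gt0 pmulr_rlt0 // /wrap_g subrr expr0n mulr0 add0r.
  rewrite pmulr_rlt0 /wrap_q -/ell; last by rewrite mulr_gt0 //; nra.
  by rewrite nmulr_llt0; lra.
have e1 : 0 < 1 :> R by [].
have /cvgrPdist_lt /(_ _ e1) [M [_ HM]] := x_omega.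
have m1 : M <= Num.max M t0 by rewrite le_max lexx.
have m2 : t0 <= Num.max M t0 by rewrite le_max lexx orbT.
have := stay (Num.max M t0 + 1) _.
have /HM /= : M < Num.max M t0 + 1 by lra.
rewrite ltr_norml => /andP[z1 z2] z3; have : 0 < x (Num.max M t0 + 1) - (pos j + 3 / 2) by apply: z3; lra.
by lra.
Qed.

Lemma connection_edge : dnn i j.
Proof.
have i_n := ltn_ord i; have j_n := ltn_ord j.
have S (k : nat) : (k < n)%N -> (k.+1 %% n = if k.+1 == n then 0 else k.+1)%N.
  move=> kn; case: eqP => [->|ne]; first by rewrite modnn.
  by rewrite modn_small //; lia.
suff : (j : nat) = (i.+1 %% n)%N \/ (j : nat) = ((i.+1 %% n).+1 %% n)%N.
  by move=> [] jE; apply/orP; [left | right]; apply/eqP/val_inj.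
rewrite (S (i.+1 %% n)%N); last by rewrite ltn_pmod //; lia.
rewrite (S i) //.
have [j2|j2] := leqP 2 j.
  by have := mover_target j2; case: (i.+1 =P n); case: eqP; lia.
by have := wrap_target j2; case: (i.+1 =P n); case: eqP; lia.
Qed.

(** Needed to tell the cycles of the network apart by the nodes that they contain. *)
Lemma connection_avoids_nodes (k : 'I_n) t : phi t <> @node R 5 n k.
Proof.
move=> phik; have := l0_pos t.
by rewrite /y /ycoord phik nodey ltxx.
Qed.

End Trajectory.

End Nonexistence.

(** * The network *)

Section Network.
Context {R : realType} {V : normedModType R}.
Variables (D : set V) (F : V -> V) (n : nat) (xi : 'I_n -> V).
Hypotheses (n3 : (3 <= n)%N) (real : realises D F xi (@dnn n)).
Hypothesis avoids : forall i j phi k t,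
  connection D F (xi i) (xi j) phi -> phi t <> xi k.

Lemma connected_between (T : topologicalType) (A B : set T) :
  connected A -> A `<=` B -> B `<=` closure A -> connected B.
Proof.
move=> cA AB BA; apply/connectedP => E [Ene BE sepE].
have AE : A `<=` E false `|` E true by rewrite -BE.
have stop b : A `<=` E b -> False.
  move=> AEb; have [x Ex] := Ene (~~ b).
  have Bx : B x by rewrite BE; case: b AEb Ex => _ ?; [left | right].
  have cx : closure (E b) x by apply: closureS AEb _ (BA x Bx).
  have [s1 s2] := sepE.
  case: b AEb Ex cx => _ Ex cx.
    by suff : set0 x by []; rewrite -s2; split.
  by suff : set0 x by []; rewrite -s1; split.
by have [] := connected_subset sepE AE cA; exact: stop.
Qed.

(** All connections along the chosen edges are included, so that the cycles together exhaust the
    network. *)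
Definition node_cycle (m : nat) (z : 'I_m -> 'I_n) : set V :=
  range (fun k => xi (z k)) `|` \bigcup_(k in [set: 'I_m])
    \bigcup_(phi in connection D F (xi (z k)) (xi (z (ordS k)))) range phi.

Lemma node_cycleP (m : nat) (z : 'I_m -> 'I_n) : (0 < m)%N -> injective z ->
  (forall k, dnn (z k) (z (ordS k))) -> heteroclinic_cycle D F (node_cycle z).
Proof.
move=> m0 zI ze; have [xiI xieq conn] := real.
exists m, (fun k => xi (z k)), (fun k => connection D F (xi (z k)) (xi (z (ordS k)))).
split=> // [k k' /xiI /zI //|k].
by split=> //; have [phi ?] := (conn _ _).2 (ze k); exists phi.
Qed.

Let n0 : (0 < n)%N. Proof. exact: leq_trans n3. Qed.

(** The enumeration starts at [i + 2] and ends at [i], so that the only double step is the one at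
    which the index wraps around modulo [n.-1]. *)
Definition skip (i : 'I_n) (k : 'I_n.-1) : 'I_n := Ordinal (ltn_pmod (i + 2 + k) n0).

Let skip_inj i : injective (skip i).
Proof.
move=> k k' /(congr1 val) /= /eqP; rewrite eqn_modDl => /eqP.
have kn := ltn_ord k; have kn' := ltn_ord k'.
by rewrite !modn_small; [move/val_inj | lia..].
Qed.

Let skip_edge i k : dnn (skip i k) (skip i (ordS k)).
Proof.
have kn := ltn_ord k; have i_n := ltn_ord i.
apply/orP; have [kk|kk] := ltnP k.+1 n.-1.
  left; apply/eqP/val_inj => /=; rewrite (modn_small kk).
  by rewrite -[((i + 2 + k) %% n)%N.+1]addn1 modnDml addn1 addnS.
right; apply/eqP/val_inj => /=.
have -> : (k.+1 %% n.-1 = 0)%N.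
  by have -> : k.+1 = n.-1 by [apply/eqP; rewrite eqn_leq kk kn]; rewrite modnn.
rewrite addn0 -[((i + 2 + k) %% n)%N.+1]addn1 modnDml.
rewrite -[((i + 2 + k + 1) %% n)%N.+1]addn1 modnDml.
have -> : (i + 2 + k + 1 + 1 = i + 2 + n)%N by lia.
by rewrite modnDr.
Qed.

Let skip_avoids i k : skip i k <> ordS i.
Proof.
move=> /(congr1 val) /= E; have kn := ltn_ord k; have i_n := ltn_ord i.
have : (i + 1 + (k + 1) == i + 1 + 0 %[mod n])%N.
  by rewrite addn0 addn1 -E; apply/eqP; congr (_ %% _)%N; lia.
by rewrite eqn_modDl mod0n modn_small; lia.
Qed.

Let skip_onto i j : j != ordS i -> exists k, skip i k = j.
Proof.
move=> ji; have i_n := ltn_ord i; have j_n := ltn_ord j.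
pose r := ((j + n + n - i - 2) %% n)%N.
have rn : (r < n)%N by rewrite ltn_pmod.
have rE : ((i + 2 + r) %% n = j)%N.
  rewrite /r modnDmr.
  have -> : (i + 2 + (j + n + n - i - 2) = j + n + n)%N by lia.
  by rewrite !modnDr modn_small.
have r1 : (r < n.-1)%N.
  rewrite ltn_neqAle; apply/andP; split; last by lia.
  apply: contra ji => /eqP rn1; apply/eqP/val_inj; rewrite /= -rE rn1.
  by have -> : (i + 2 + n.-1 = i.+1 + n)%N by [lia]; rewrite modnDr.
by exists (Ordinal r1); apply/val_inj.
Qed.

(* The cycle through all nodes, and those that use the edge from [i] to
   [ordS (ordS i)] to leave out [ordS i]. *)
Let C (k : 'I_n.+1) : set V :=
  if unlift ord0 k is Some i then node_cycle (skip i) else node_cycle id.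

Let skip_cycle_node i j : node_cycle (skip i) (xi j) -> j != ordS i.
Proof.
have [xiI _ _] := real.
move=> [[k _ /xiI <-]|[k _ [phi phiC [t _ tE]]]].
  by apply/eqP; exact: skip_avoids.
by case: (avoids phiC tE).
Qed.

Let node_skip_cycle i j : j != ordS i -> node_cycle (skip i) (xi j).
Proof. by move=> /skip_onto [k <-]; left; exists k. Qed.

(** The cycle of [skip i] contains every node but [ordS i]. *)
Let C_inj : injective C.
Proof.
move=> k k'; rewrite /C.
case: (unliftP ord0 k) => [i ->|->]; case: (unliftP ord0 k') => [i' ->|->] //= E.
- have [/(bij_inj (@ordS_bij n)) -> //|ne] := eqVneq (ordS i) (ordS i').
  have := node_skip_cycle ne; rewrite -?E => H.
  have := node_skip_cycle (i := i') ne; rewrite -E => /skip_cycle_node.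
  by rewrite eqxx.
- have : node_cycle (skip i) (xi (ordS i)) by rewrite E; left; exists (ordS i).
  by move=> /skip_cycle_node; rewrite eqxx.
- have : node_cycle (skip i') (xi (ordS i')) by rewrite -E; left; exists (ordS i').
  by move=> /skip_cycle_node; rewrite eqxx.
Qed.

Lemma connection_connected i j phi : connection D F (xi i) (xi j) phi ->
  connected (range phi `|` [set xi i; xi j]).
Proof.
move=> [tr _ la lo].
have cphi : continuous phi.
  move=> t; have [_ [d _]] := tr t.
  exact/differentiable_continuous/derivable1_diffP.
apply: (@connected_between _ (range phi)).
- apply: connected_continuous_connected; last exact: continuous_subspaceT.
  by apply/connected_intervalP => ? ? ? ? ? ?.
- by move=> ? ?; left.
have lim_closure (G : set_system R) (GG : ProperFilter G) a :
    phi t @[t --> G] --> a -> closure (range phi) a.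
  move=> Ga B nB; have GB : G (phi @^-1` B) by exact: Ga nB.
  have [t Bt] := filter_ex GB.
  by exists (phi t); split=> //; exists t.
move=> _ [[t _ <-]|[->|->]].
- by apply: subset_closure; exists t.
- exact: lim_closure la.
- exact: lim_closure lo.
Qed.

Let X := nodes_and_connections D F xi.

(** A connection together with its two ends is connected, and the edges from [k] to [k + 1] link
    every node to the first one. *)
Let X_connected : connected X.
Proof.
have [xiI _ conn] := real.
have sub i j phi : connection D F (xi i) (xi j) phi ->
    range phi `|` [set xi i; xi j] `<=` X.
  move=> phiC _ [[t _ <-]|[->|->]]; [right | left; exists i | left; exists j] => //.
  by exists i, j, phi; split=> //; exists t.
have link i j phi p q : connection D F (xi i) (xi j) phi ->
    (range phi `|` [set xi i; xi j]) p -> (range phi `|` [set xi i; xi j]) q ->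
    connected_component X p q.
  move=> phiC Ap Aq.
  exact: (connected_component_max Ap (sub _ _ _ phiC) (connection_connected phiC)) q Aq.
pose o : 'I_n := Ordinal n0.
have nodes k (kn : (k < n)%N) : connected_component X (xi o) (xi (Ordinal kn)).
  elim: k kn => [|k IH] kn.
    have -> : Ordinal kn = o by exact: val_inj.
    by apply: connected_component_refl; left; exists o.
  have kn' := ltnW kn; apply: connected_component_trans (IH kn') _.
  have [phi phiC] : exists phi, connection D F (xi (Ordinal kn')) (xi (Ordinal kn)) phi.
    apply/conn/orP; left; apply/eqP/val_inj => /=.
    by rewrite modn_small.
  by apply: (link _ _ _ _ _ phiC); right; [left | right].
suff -> : X = connected_component X (xi o) by exact: component_connected.
apply/seteqP; split; last exact: connected_component_sub.
move=> p [[[k kn] _ <-]|[i [j [phi [phiC phip]]]]]; first exact: nodes.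
apply: connected_component_trans (_ : connected_component X (xi i) p).
  by case: i phiC => k kn _; exact: nodes.
by apply: (link _ _ _ _ _ phiC); [right; left | left].
Qed.

Lemma dnn_network : heteroclinic_network D F X.
Proof.
have [xiI xieq conn] := real.
split; first exact: X_connected.
exists n.+1, C; split; [by lia | exact: C_inj | |].
  move=> k; rewrite /C; case: unliftP => [i _|_].
    by apply: node_cycleP; [lia | exact: skip_inj | exact: skip_edge].
  by apply: node_cycleP => // k'; rewrite /dnn eqxx.
have CX (m : nat) (z : 'I_m -> 'I_n) : node_cycle z `<=` X.
  move=> p [[k _ <-]|[k _ [phi phiC phip]]]; first by left; exists (z k).
  by right; exists (z k), (z (ordS k)), phi.
apply/seteqP; split=> p; last first.
  by move=> [k _]; rewrite /C; case: unlift => [i|]; exact: CX.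
move=> [[k _ <-]|[i [j [phi [phiC phip]]]]].
  by exists ord0 => //; rewrite /C unlift_none; left; exists k.
have /orP[/eqP jE|/eqP jE] := (conn i j).1 (ex_intro _ phi phiC).
  exists ord0 => //; rewrite /C unlift_none; right.
  by exists i => //; exists phi => //; rewrite -jE.
exists (lift ord0 i) => //; rewrite /C liftK; right.
(* The last index [n - 2] is sent to [i], and its cyclic successor 0 to [i + 2]. *)
have kn : (n - 2 < n.-1)%N by lia.
exists (Ordinal kn) => //; exists phi => //.
suff [-> ->] : skip i (Ordinal kn) = i /\ skip i (ordS (Ordinal kn)) = j by [].
have i_n := ltn_ord i.
split; apply/val_inj => /=.
  have -> : (i + 2 + (n - 2) = i + n)%N by lia.
  by rewrite modnDr modn_small.
have -> : ((n - 2).+1 %% n.-1 = 0)%N.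
  by have -> : (n - 2).+1 = n.-1 by [lia]; rewrite modnn.
by rewrite jE /= addn0 -[(i.+1 %% n)%N.+1]addn1 modnDml addn1 addn2.
Qed.

End Network.

(** * The nodes and the conclusion *)

Section Nodes.
Context {R : realType}.
Variable n : nat.

Lemma node_inj : injective (@node R 5 n).
Proof.
move=> i j /(congr1 (fun z : 'rV[R]_6 => z ord0 ord0)); rewrite !mxE eqxx => /eqP.
by rewrite eqr_nat => /eqP ijE; apply/ord_inj; lia.
Qed.

Lemma node_equilibrium eps (i : 'I_n) :
  equilibrium (@phase_space R 5) (vector_field n (sys_f n) (sys_g n) eps) (node R 5 i).
Proof.
have y0 l : ycoord (node R 5 i) l = 0.
  by rewrite /ycoord mxE eq_sym (negbTE (neq_lift _ _)).
split=> [l|]; first by rewrite y0.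
apply/rowP => k; rewrite vector_fieldE [RHS]mxE; case: unlift => [l|].
  by rewrite y0 mul0r.
rewrite big1 ?addr0 => [|l _]; last by rewrite y0 mul0r.
by rewrite /xcoord mxE eqxx -/(pos i) drift_pos ?oppr0 ?mulr0.
Qed.

End Nodes.

Unset Implicit Arguments.

Theorem theorem4p1 (R : realType) (n : nat) (n_ge3 : (3 <= n)%N) :
  exists f g : 'I_5 -> {poly {poly R}},
    \forall eps \near (0 : R)^'+,
      realises_as_network (@phase_space R 5) (vector_field n f g eps)
        (@node R 5 n) (@dnn n).
Proof.
exists (sys_f n), (sys_g n).
(* There are finitely many edges, so one bound on [eps] serves them all. *)
have orbits : \forall eps \near (0 : R)^'+, forall i j : 'I_n, dnn i j -> exists X Y,
    planar_orbit (fun x => eps * - (drift_poly n).[x]) (field_f n (label j))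
      (field_g n (label j)) (pos i) (pos j) X Y.
  apply: filter_forall => i; apply: filter_forall => j.
  have [ij|ij] := boolP (dnn i j); last by apply: nearW.
  by apply: filterS (edge_orbit n_ge3 ij) => eps XY _.
near=> eps.
have eps0 : 0 < eps by near: eps; exact: nbhs_right_gt.
have orb : forall i j : 'I_n, dnn i j -> exists X Y,
    planar_orbit (fun x => eps * - (drift_poly n).[x]) (field_f n (label j))
      (field_g n (label j)) (pos i) (pos j) X Y by near: eps.
have real : realises (@phase_space R 5) (vector_field n (sys_f n) (sys_g n) eps)
    (@node R 5 n) (@dnn n).
  split; [exact: node_inj | exact: node_equilibrium |].
  move=> i j; split=> [[phi phiC]|ij]; first exact: (connection_edge n_ge3 eps0 phiC).
  by have [X [Y XY]] := orb i j ij; exact: (lift_orbit XY).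
split=> //; apply: dnn_network => // i j phi k t phiC.
exact: (connection_avoids_nodes n_ge3 eps0 phiC).
Unshelve. all: by end_near. Qed.
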